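(* Let $\theta>0$, $h>0$, and let $H=L^2([0,h],\beta_{[0,h]},\lambda+\delta_{(h)})$. Let $\{\xi_t,\ t\in\mathbb{R}\}$ be the Ornstein-Uhlenbeck process with parameter $\theta$, let $X_n(t)=\xi_{nh+t}$ for $0\le t\le h$, $n\in\mathbb{Z}$, and for each integer $n\ge 1$ let $\widehat{\theta}_n$ be the maximum likelihood estimator of $\theta$ based on the observation of $\xi$ on $[0,T]$ with $T=nh$. Then the plug-in predictor $\widehat{X}_n=\rho_{\widehat{\theta}_n}(X_{n-1})$ is consistent in $H$, i.e. $$\left\|(\rho_\theta-\rho_{\widehat{\theta}_n})(X_{n-1})\right\|_H\longrightarrow 0\quad\text{in probability, as } n\to\infty.$$
   Context: $W=\{W_t,\ t\in\mathbb{R}\}$ is a standard bilateral (two-sided) Wiener process on a probability space $(\Omega,\mathcal{A},\mathcal{P})$. The Ornstein-Uhlenbeck (O.U.) process with parameter $\theta>0$ is the zero-mean stationary Gaussian process with continuous sample paths $\xi_t=\int_{-\infty}^{t}e^{-\theta(t-s)}\,dW_s$, $t\in\mathbb{R}$ (covariance $\frac{1}{2\theta}e^{-\theta|t-s|}$). $\beta_{[0,h]}$ is the Borel $\sigma$-algebra of $[0,h]$, $\lambda$ is Lebesgue measure and $\delta_{(h)}$ is the Dirac measure at the point $h$. The norm of $H$ is $\|f\|_H=\sqrt{\int_0^h f(t)^2\,dt+f(h)^2}$; two functions are identified iff they agree Lebesgue-a.e. and at the point $h$, so $x\mapsto x(h)$ is well defined on $H$. For a real number $u$, the operator $\rho_u$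 is defined by $\rho_u(x)(t)=e^{-ut}x(h)$, $0\le t\le h$, $x\in H$. Thus $\widehat{X}_n(t)=\rho_{\widehat{\theta}_n}(X_{n-1})(t)=e^{-\widehat{\theta}_n t}X_{n-1}(h)$, $0\le t\le h$. The maximum likelihood estimator of $\theta$ based on $\{\xi_t,\ t\in[0,T]\}$ is $$\widehat{\theta}_T=\frac{1+\frac{\xi_0^2}{T}-\frac{\xi_T^2}{T}}{\frac{2}{T}\int_0^T\xi_t^2\,dt},\quad T>0,$$ and $\widehat{\theta}_n$ denotes this estimator with $T=nh$. *)

(* Defs.v *)
From mathcomp Require Import all_boot all_order all_algebra.
From mathcomp Require Import all_classical all_reals all_analysis.
From mathcomp Require Import measurable_realfun.
Set Implicit Arguments.
Unset Strict Implicit.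
Unset Printing Implicit Defensive.
Import Order.TTheory GRing.Theory Num.Theory.
Import numFieldNormedType.Exports.
Local Open Scope classical_set_scope.
Local Open Scope ring_scope.

Section Processes.
Context (R : realType) (d : measure_display) (Omega : measurableType d)
  (P : probability Omega R).

(* Taking some of the [B i] equal to [setT] gives the product rule for every
   subfamily. *)
Definition mutually_independent (k : nat) (Z : 'I_k -> Omega -> R) : Prop :=
  forall B : 'I_k -> set R, (forall i, measurable (B i)) ->
    P (\bigcap_(i in [set: 'I_k]) (Z i @^-1` B i)) =
    (\prod_(i < k) P (Z i @^-1` B i))%E.

Record two_sided_wiener (W : R -> {RV P >-> R}) : Prop := TwoSidedWiener {
  wiener_at0 : {ae P, forall w, W 0 w = 0} ;
  wiener_independent_increments : forall (k : nat) (t : nat -> R),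
    {homo t : i j / (i <= j)%N >-> i <= j} ->
    mutually_independent (fun (i : 'I_k) w => W (t i.+1) w - W (t i) w) ;
  (* the second parameter of [normal_prob] is the standard deviation *)
  wiener_normal_increments : forall s t : R, s < t ->
    forall B : set R, measurable B ->
    P [set w | B (W t w - W s w)] = normal_prob 0 (Num.sqrt (t - s)) B ;
  wiener_continuous_paths : {ae P, forall w, continuous (fun t => W t w : R)} }.

(* Only the first [sf_size] intervals ]sf_pt i, sf_pt i.+1] count. *)
Record step_function : Type := StepFunction {
  sf_size : nat ;
  sf_pt : nat -> R ;
  sf_coef : nat -> R ;
  sf_pt_homo : {homo sf_pt : i j / (i <= j)%N >-> i <= j} }.

Definition step_fun (f : step_function) (s : R) : R :=
  \sum_(i < sf_size f) sf_coef f i * \1_`]sf_pt f i, sf_pt f i.+1] s.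

Definition step_wiener_integral (W : R -> {RV P >-> R}) (f : step_function)
    (w : Omega) : R :=
  \sum_(i < sf_size f) sf_coef f i * (W (sf_pt f i.+1) w - W (sf_pt f i) w).

(* [I] is a version of [\int f dW]: the extension by L^2-isometry of the
   integral of step functions. *)
Definition is_wiener_integral (W : R -> {RV P >-> R}) (f : R -> R)
    (I : {RV P >-> R}) : Prop :=
  exists phi : nat -> step_function,
    ('N[@lebesgue_measure R]_2%:E
        [EFin \o (fun s => (f s - step_fun (phi m) s)%R)] @[m --> \oo] --> 0)%E /\
    ('N[P]_2%:E
        [EFin \o (fun w => (I w - step_wiener_integral W (phi m) w)%R)]
        @[m --> \oo] --> 0)%E.

(* Continuity is required of every path, so that time integrals of the paths are
   random variables even when P is not complete. *)
Record ornstein_uhlenbeck (theta : R) (W xi : R -> {RV P >-> R}) : Prop :=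
  OrnsteinUhlenbeck {
  ou_wiener_integral : forall t : R,
    is_wiener_integral W
      (fun s => \1_`]-oo, t] s * expR (- (theta * (t - s)))) (xi t) ;
  ou_continuous_paths : forall w, continuous (fun t => xi t w : R) }.

Definition segment (xi : R -> {RV P >-> R}) (h : R) (n : int) (w : Omega)
    (t : R) : R :=
  xi (n%:~R * h + t) w.

(* T > 0 is intended. Division by 0 gives 0; for T > 0 the integral vanishes with
   probability 0. *)
Definition ou_mle (xi : R -> {RV P >-> R}) (T : R) (w : Omega) : R :=
  (1 + xi 0 w ^+ 2 / T - xi T w ^+ 2 / T) /
  (2 / T * (\int[@lebesgue_measure R]_(t in `[0, T]) (xi t w ^+ 2))%R).

Definition cvg_in_probability (Z : nat -> Omega -> \bar R)
    (Zlim : Omega -> \bar R) : Prop :=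
  forall eps : R, 0 < eps ->
    (P [set w | eps%:E < `|Z n w - Zlim w|] @[n --> \oo] --> 0)%E.

End Processes.

Section StateSpace.
Context (R : realType).

(* The measure [lambda + delta_h] of [0, h], seen as a measure on the line
   carried by [0, h]; elements of H are represented by functions on the line,
   whose values outside of [0, h] are irrelevant. *)
Definition state_measure (h : R) : {measure set (measurableTypeR R) -> \bar R} :=
  measure_add
    (mrestr (@lebesgue_measure R) (measurable_itv `[0, h])) \d_(h : measurableTypeR R).

Definition Hnorm (h : R) (f : R -> R) : \bar R :=
  ('N[state_measure h]_2%:E [EFin \o f])%E.

(* The value x h is meaningful on classes of almost everywhere equal functions,
   see [rho_ae_eq]. *)
Definition rho (h u : R) (x : R -> R) : R -> R :=
  fun t => expR (- (u * t)) * x h.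

Lemma rho_ae_eq (h u : R) (x y : R -> R) :
  ae_eq (state_measure h) setT x y -> rho h u x = rho h u y.
Proof.
case=> N [mN N0 xyN]; apply/funext => t; rewrite /rho; congr (_ * _).
apply: contrapT => xy.
have hN : N h by apply: xyN => /= /(_ I).
have := measure_addE (mrestr (@lebesgue_measure R) (measurable_itv `[0, h]))
  \d_(h : measurableTypeR R) N.
rewrite [LHS]N0/= diracE mem_set// => /esym/eqP.
rewrite padde_eq0//.

by move=> /andP[_]; rewrite onee_eq0.
Qed.

Lemma Hnorm_sqr (h : R) (f : R -> R) : measurable_fun setT f ->
  (Hnorm h f `^ 2 = \int[@lebesgue_measure R]_(t in `[0%R, h]) (f t ^+ 2)%:E
                    + (f h ^+ 2)%:E)%E.
Proof.
move=> mf; rewrite /Hnorm poweR_Lnorm//.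
under eq_integral do rewrite /= powR_mulrn// real_normK ?num_real//.
have mf2 := (measurable_EFinP _ _).2 (measurable_funX 2 mf).
rewrite [LHS]ge0_integral_measure_add//; last by move=> x _; rewrite lee_fin sqr_ge0.
congr (_ + _)%E.
  rewrite -(setUv `[0, h]) ge0_integral_setU//=; last first.
  - by apply/disj_set2P; rewrite setICr.
  - by move=> x _; rewrite lee_fin sqr_ge0.
  - by rewrite setUv.
  - exact: measurableC.
  rewrite [X in (_ + X)%E](_ : _ = 0%E) ?adde0; last first.
    rewrite null_set_integral//; [exact: measurableC|exact: measurable_funTS mf2|].
    by rewrite /= /mrestr setICl measure0.
  apply: eq_measure_integral => A mA A0h.
  by rewrite /= /mrestr setIidl.
by rewrite integral_dirac// diracT mul1e.
Qed.

End StateSpace.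

(* Main.v *)
(** The estimator is a continuous function of the energy
    [A_T = T^-1 \int_0^T xi_t^2 dt] and of two boundary terms which are bounded
    in probability before division by [T], so that everything rests on
    [A_T --> 1/(2 theta)] in L^1. This does not require any moment of [xi] beyond
    the second one. Fix a mesh [delta] and put [a = exp(- theta delta)]. By the
    Wiener isometry, [xi_(t+delta) - a xi_t - (W_(t+delta) - W_t)] has L^2 norm at
    most [theta delta^(3/2)], hence along the grid [xi] stays within
    [O(sqrt delta)], up to a geometrically vanishing error, of the autoregression
    [eta_0 = 0], [eta_(j+1) = a eta_j + Z_j] driven by the independent increments
    [Z_j] of [W]. Squaring the recursion and summing gives
    [(1 - a^2) \sum_(j < N) eta_j^2 = N delta - eta_N^2 + M_N] where [M] is a
    martingale with [E M_N^2 = O(N)]. So the averages of [eta_j^2] tend to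
    [delta / (1 - a^2)], which is within [delta] of [1/(2 theta)]; let [N] tend to
    infinity, then [delta] to 0. *)

Require Import Defs.
From mathcomp Require Import all_boot all_order all_algebra.
From mathcomp Require Import all_classical all_reals all_analysis.
From mathcomp Require Import measurable_realfun.
From mathcomp Require Import ring lra.
Set Implicit Arguments.
Unset Strict Implicit.
Unset Printing Implicit Defensive.
Import Order.TTheory GRing.Theory Num.Theory.
Import numFieldNormedType.Exports.
Local Open Scope classical_set_scope.
Local Open Scope ring_scope.

(** * L2 bounds *)

(** The process [xi] is known only through L^2 approximations by step integrals, while the
    increments of [W] have a known law. Hence the comparison with a sequence built from true
    increments: their fourth moments control the martingale, and [xi] enters through L^2 distances
    alone. Energies are then compared in L^1, since f^2 - g^2 = (f - g)(f + g) costs one application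
    of Cauchy-Schwarz. The rate sqrt delta is the local error theta delta^(3/2) divided by the
    contraction gap 1 - a, which is of order theta delta. The constant in front of N^(-1/2) blows up
    as delta tends to 0, so the mesh has to be fixed before N grows. For the predictor, X_(n-1)(h) =
    xi_(nh) is only bounded in probability, and the estimator may be negative, where u -> exp(- u t)
    is no longer 1-Lipschitz up to the factor t. Everything is therefore estimated on an event of
    large probability on which the estimator is within theta of theta. *)

Section EFin_integrable.
Context d (T : measurableType d) (R : realType).
Variable mu : {measure set T -> \bar R}.
Implicit Types f g : T -> R.

Lemma integrable_EFinD f g : mu.-integrable setT (EFin \o f) ->
  mu.-integrable setT (EFin \o g) ->
  mu.-integrable setT (EFin \o (fun x => f x + g x)).
Proof. by move=> fi gi; apply: eq_integrable (integrableD _ fi gi). Qed.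

Lemma integrable_EFinZ (k : R) f : mu.-integrable setT (EFin \o f) ->
  mu.-integrable setT (EFin \o (fun x => k * f x)).
Proof. by move=> fi; apply: eq_integrable (integrableZl _ k fi). Qed.

Lemma le_integrable_EFin f g : measurable_fun setT f ->
  (forall x, `|f x| <= g x) -> mu.-integrable setT (EFin \o g) ->
  mu.-integrable setT (EFin \o f).
Proof.
move=> mf fg; apply: le_integrable => //; first exact/measurable_EFinP.
by move=> x _ /=; rewrite lee_fin (le_trans (fg x))// ler_norm.
Qed.

End EFin_integrable.

Section L2_bounds.
Context d (T : measurableType d) (R : realType).
Variable mu : {measure set T -> \bar R}.
Implicit Types (f g : T -> R) (a b c : R).

Lemma Lnorm2_sqr f :
  ('N[mu]_2%:E[EFin \o f] `^ 2 = \int[mu]_x (f x ^+ 2)%:E)%E.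
Proof.
rewrite poweR_Lnorm//; apply: eq_integral => x _ /=.
by rewrite powR_mulrn// real_normK ?num_real.
Qed.

Lemma Lnorm2_le f c : 0 <= c ->
  ('N[mu]_2%:E[EFin \o f] <= c%:E)%E <->
  (\int[mu]_x (f x ^+ 2)%:E <= (c ^+ 2)%:E)%E.
Proof.
move=> c0; rewrite -Lnorm2_sqr; set N := ('N[mu]_2%:E[_])%E.
have N0 : (0 <= N)%E by exact: Lnorm_ge0.
have [->|] := eqVneq N +oo%E.
  by rewrite poweRyr// !leye_eq.
rewrite -ltey -ge0_fin_numE// => /fineK NE.
rewrite -NE poweR_EFin !lee_fin powR_mulrn ?fine_ge0//.
by rewrite ler_pXn2r// nnegrE fine_ge0.
Qed.

(** Bundling measurability and the sign of [c] with the bound lets such bounds be added and scaled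
    like norms, without side conditions. *)
Definition L2le f c :=
  [/\ measurable_fun setT f, 0 <= c & (\int[mu]_x (f x ^+ 2)%:E <= (c ^+ 2)%:E)%E].

Lemma L2leP f c : measurable_fun setT f -> 0 <= c ->
  L2le f c <-> ('N[mu]_2%:E[EFin \o f] <= c%:E)%E.
Proof. by move=> mf c0; rewrite Lnorm2_le//; split=> [[]//|]; split. Qed.

Lemma L2le_le f b c : b <= c -> L2le f b -> L2le f c.
Proof.
move=> bc [mf b0 fb]; split => //; first exact: le_trans bc.
by rewrite (le_trans fb)// lee_fin lerXn2r// nnegrE (le_trans b0).
Qed.

Lemma L2le_eq f g c : f =1 g -> L2le f c -> L2le g c.
Proof. by move=> /funext ->. Qed.

Lemma L2leD f g a b : L2le f a -> L2le g b -> L2le (fun x => f x + g x) (a + b).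
Proof.
move=> fa gb; have [mf a0 _] := fa; have [mg b0 _] := gb.
apply/L2leP; [exact: measurable_funD|exact: addr_ge0|].
rewrite EFinD; apply: le_trans (leeD ((L2leP mf a0).1 fa) ((L2leP mg b0).1 gb)).
by apply: minkowski_EFin => //; rewrite (ler1n R 2).
Qed.

Lemma L2leZ k f a : L2le f a -> L2le (fun x => k * f x) (`|k| * a).
Proof.
move=> [mf a0 fa]; split; [exact: measurable_funM|exact: mulr_ge0|].
under eq_integral do rewrite exprMn EFinM.
rewrite ge0_integralZl_EFin ?sqr_ge0//; last 2 first.
- by move=> x _; rewrite lee_fin sqr_ge0.
- by apply/measurable_EFinP; exact: measurable_funX.
by rewrite exprMn real_normK ?num_real// [leRHS]EFinM lee_wpmul2l// lee_fin sqr_ge0.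
Qed.

Lemma L2leN f a : L2le f a -> L2le (fun x => - f x) a.
Proof.
move=> [mf a0 fa]; split=> //; first exact: measurableT_comp.
by under eq_integral do rewrite sqrrN.
Qed.

Lemma L2leB f g a b : L2le f a -> L2le g b -> L2le (fun x => f x - g x) (a + b).
Proof. by move=> fa /L2leN; exact: L2leD. Qed.

Lemma le_L2le f g c : measurable_fun setT f -> (forall x, `|f x| <= `|g x|) ->
  L2le g c -> L2le f c.
Proof.
move=> mf fg [mg c0 gc]; split => //; apply: le_trans gc.
apply: ge0_le_integral => //.
- by move=> x _; rewrite lee_fin sqr_ge0.
- by apply/measurable_EFinP; exact: measurable_funX.
- by apply/measurable_EFinP; exact: measurable_funX.
- move=> x _; rewrite lee_fin -(real_normK (num_real (f x))).
  by rewrite -(real_normK (num_real (g x))) lerXn2r ?nnegrE.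
Qed.

Lemma L2le_mul f g a b : L2le f a -> L2le g b ->
  (\int[mu]_x (`|f x * g x|)%:E <= (a * b)%:E)%E.
Proof.
move=> fa gb; have [mf a0 _] := fa; have [mg b0 _] := gb.
have := @hoelder _ _ _ mu f g 2 2 mf mg; rewrite Lnorm1.
have e : 2^-1 + 2^-1 = 1 :> R by rewrite [RHS]splitr !div1r.
move=> /(_ (ltr0Sn _ _) (ltr0Sn _ _) e) /le_trans; apply.
rewrite EFinM; apply: lee_pmul; rewrite ?Lnorm_ge0//.
  exact/L2leP.
exact/L2leP.
Qed.

Lemma L2le_integrableM f g a b : L2le f a -> L2le g b ->
  mu.-integrable setT (EFin \o (fun x => f x * g x)).
Proof.
move=> fa gb; have [mf a0 _] := fa; have [mg b0 _] := gb.
apply/integrableP; split; first by apply/measurable_EFinP; exact: measurable_funM.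
exact: le_lt_trans (L2le_mul fa gb) (ltry _).
Qed.

Lemma L2le_integrable_sqr f a : L2le f a ->
  mu.-integrable setT (EFin \o (fun x => f x ^+ 2)).
Proof.
by move=> fa; apply: eq_integrable (L2le_integrableM fa fa).
Qed.

Lemma L2le_Rintegral f a : L2le f a -> \int[mu]_x (f x ^+ 2) <= a ^+ 2.
Proof.
move=> fa; have := L2le_integrable_sqr fa; case: fa => mf a0 fa fi.
by rewrite -lee_fin fineK// integrable_fin_num.
Qed.

Lemma integrable_L2le f : measurable_fun setT f ->
  mu.-integrable setT (EFin \o (fun x => f x ^+ 2)) -> exists c, L2le f c.
Proof.
move=> mf fi; exists (Num.sqrt (\int[mu]_x (f x ^+ 2))); split => //.
rewrite sqr_sqrtr ?fineK ?integrable_fin_num//.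
by apply: Rintegral_ge0 => x _; exact: sqr_ge0.
Qed.

(** Serves to remove the approximation error once Wiener integrals have been replaced by step
    integrals. *)
Lemma L2le_eps f c : 0 <= c -> (forall e, 0 < e -> L2le f (c + e)) -> L2le f c.
Proof.
move=> c0 fe; have [mf _ _] := fe 1 ltr01; apply/L2leP => //.
by apply/lee_addgt0Pr => e e0; rewrite -EFinD; apply/L2leP; [|lra|exact: fe].
Qed.

End L2_bounds.

Section L2_finite.
Context d (T : measurableType d) (R : realType) (P : probability T R).
Implicit Types (f : T -> R).

Lemma Rintegral_probability_cst (k : R) : \int[P]_w k = k.
Proof.
rewrite /Rintegral; have /= -> := integral_cst P measurableT k%:E.
by rewrite probability_setT mule1.
Qed.

Lemma L2le_cst (k : R) : L2le P (cst k) `|k|.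
Proof.
split => //; have /= -> := integral_cst P measurableT (k ^+ 2)%:E.
rewrite probability_setT mule1.
by rewrite real_normK// num_real.
Qed.

Lemma L2le_integral f c : L2le P f c -> (\int[P]_x (`|f x|)%:E <= c%:E)%E.
Proof.
move=> fc; have := L2le_mul fc (L2le_cst 1).
by rewrite normr1 mulr1; under eq_integral do rewrite mulr1.
Qed.

Lemma L2le_integrable f c : L2le P f c -> P.-integrable setT (EFin \o f).
Proof.
move=> fc; apply: eq_integrable (L2le_integrableM fc (L2le_cst 1)) => // x _ /=.
by rewrite mulr1.
Qed.

End L2_finite.

(** * Moments of the normal law *)

Section normal_moments.
Context (R : realType).
Notation mu := (@lebesgue_measure R).

(** [normal_pdf] and the Radon-Nikodym derivative of [normal_prob] have the same integral over every
    measurable set, hence agree almost everywhere. *)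
Lemma ge0_integral_normal_prob (m s : R) (f : R -> \bar R) :
  measurable_fun setT f -> (forall x, 0 <= f x)%E ->
  (\int[normal_prob m s]_x f x = \int[mu]_x (f x * (normal_pdf m s x)%:E))%E.
Proof.
move=> mf f0.
have dom := @normal_prob_dominates R m s.
rewrite -(Radon_Nikodym_SigmaFinite.change_of_variables dom)//.
apply: ae_eq_integral => //.
- apply: emeasurable_funM => //.
  exact: measurable_int (Radon_Nikodym_SigmaFinite.f_integrable dom).
- apply: emeasurable_funM => //; apply/measurable_EFinP.
  exact: measurable_normal_pdf.
- apply: ae_eqe_mul2l; apply: integral_ae_eq => //.
  + exact: (Radon_Nikodym_SigmaFinite.f_integrable dom).
  + by apply/measurable_EFinP; exact: measurable_normal_pdf.
  + by move=> A _ mA; rewrite -Radon_Nikodym_SigmaFinite.f_integral.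
Qed.

Lemma normal_peakE (s : R) : 0 < s -> normal_peak s = s^-1 * (Num.sqrt (pi *+ 2))^-1.
Proof.
move=> s0; rewrite /normal_peak -mulrnAr sqrtrM ?sqr_ge0// sqrtr_sqr.
by rewrite invfM gtr0_norm.
Qed.

(** Comparing densities of different scales, all of mass one, replaces integration by parts in the
    computation of moments. *)
Lemma normal_pdf_scale (s r x : R) : 0 < s -> 0 < r ->
  normal_pdf 0 (s / r) x =
  r * expR ((1 - r ^+ 2) * (x ^+ 2 / (s ^+ 2 *+ 2))) * normal_pdf 0 s x.
Proof.
move=> s0 r0; have sr : 0 < s / r by exact: divr_gt0.
rewrite !normal_pdfE ?gt_eqF// !normal_peakE// /normal_fun !subr0.
rewrite mulrACA -expRD; congr (_ * expR _); last by field; rewrite !gt_eqF.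
have : 0 < Num.sqrt (pi *+ 2 : R) by rewrite sqrtr_gt0 pmulrn_lgt0 ?pi_gt0.
by move: (Num.sqrt _) => q q0; field; rewrite !gt_eqF.
Qed.

(** Doubling the deviation multiplies the density by exp(y) / 2 with y = 3 x^2 / (8 s^2), and exp(y)
    >= 1 + y^2 / 2 absorbs the fourth power. The constant 32 is not sharp. *)
Lemma normal_pdf_fourth (s x : R) : 0 < s ->
  x ^+ 4 * normal_pdf 0 s x <= 32 * s ^+ 4 * normal_pdf 0 (s / 2^-1) x.
Proof.
move=> s0; rewrite normal_pdf_scale ?invr_gt0// mulrA ler_wpM2r ?normal_pdf_ge0//.
set y := (1 - 2^-1 ^+ 2) * (x ^+ 2 / (s ^+ 2 *+ 2)).
have y0 : 0 <= y.
  apply: mulr_ge0; first by lra.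
  by rewrite divr_ge0 ?sqr_ge0// mulrn_wge0// sqr_ge0.
have := expR_ge1Dxn 1 y0; rewrite (_ : 2`!%:R = 2 :> R)// => ye.
have -> : x ^+ 4 = y ^+ 2 * (64 / 9) * s ^+ 4.
  by rewrite /y; field; rewrite gt_eqF.
rewrite mulrC (_ : 32 * _ * _ = s ^+ 4 * (16 * expR y)); last by field.
rewrite ler_wpM2l ?exprn_ge0 ?ltW//; have := sqr_ge0 y; lra.
Qed.

Lemma measurable_exprn_normal_pdf (n : nat) (s : R) :
  measurable_fun setT (fun x : R => (x ^+ n * normal_pdf 0 s x)%:E).
Proof.
apply/measurable_EFinP; apply: measurable_funM; last exact: measurable_normal_pdf.
exact: measurable_funX.
Qed.

Lemma integrable_fourth_normal_pdf (s : R) : 0 < s ->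
  mu.-integrable setT (EFin \o (fun x : R => x ^+ 4 * normal_pdf 0 s x)).
Proof.
move=> s0; apply: (@le_integrable_EFin _ _ _ mu _
  (fun x => 32 * s ^+ 4 * normal_pdf 0 (s / 2^-1) x)).
- by apply/measurable_EFinP; exact: measurable_exprn_normal_pdf.
- move=> x /=; rewrite ger0_norm ?normal_pdf_fourth//.
  by rewrite mulr_ge0 ?normal_pdf_ge0// exprn_even_ge0.
- by apply: integrable_EFinZ; exact: integrable_normal_pdf.
Qed.

Lemma integrable_sqr_normal_pdf (s : R) : 0 < s ->
  mu.-integrable setT (EFin \o (fun x : R => x ^+ 2 * normal_pdf 0 s x)).
Proof.
move=> s0; apply: (@le_integrable_EFin _ _ _ mu _
  (fun x => normal_pdf 0 s x + x ^+ 4 * normal_pdf 0 s x)).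
- by apply/measurable_EFinP; exact: measurable_exprn_normal_pdf.
- move=> x; rewrite -{2}[normal_pdf 0 s x]mul1r -mulrDl.
  rewrite ger0_norm; last by rewrite mulr_ge0 ?normal_pdf_ge0// sqr_ge0.
  rewrite ler_wpM2r ?normal_pdf_ge0// (_ : x ^+ 4 = (x ^+ 2) ^+ 2); last first.
    by rewrite -exprM.
  by have := sqr_ge0 (x ^+ 2 - 1); have := sqr_ge0 (x ^+ 2); nra.
- apply: integrable_EFinD; first exact: integrable_normal_pdf.
  exact: integrable_fourth_normal_pdf.
Qed.

(* Comparing the normalisations of the scaled densities through
   [expR y >= 1 + y] bounds the variance on both sides, by letting the scale
   factor tend to 1. *)
Lemma Rintegral_sqr_normal_pdf (s : R) : 0 < s ->
  \int[mu]_x (x ^+ 2 * normal_pdf 0 s x) = s ^+ 2.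
Proof.
move=> s0; set v := LHS.
have i1 := integrable_normal_pdf 0 s; have i2 := integrable_sqr_normal_pdf s0.
have key r : 0 < r -> r * (1 + (1 - r ^+ 2) * (v / (s ^+ 2 *+ 2))) <= 1.
  move=> r0.
  have pdf1 t : \int[mu]_x normal_pdf 0 t x = 1 :> R.
    by rewrite /Rintegral integral_normal_pdf.
  rewrite -[leRHS](pdf1 (s / r)).
  have -> : r * (1 + (1 - r ^+ 2) * (v / (s ^+ 2 *+ 2))) =
      \int[mu]_x (r * normal_pdf 0 s x + (r * (1 - r ^+ 2) / (s ^+ 2 *+ 2)) *
                  (x ^+ 2 * normal_pdf 0 s x)).
    rewrite RintegralD//=; [|exact: integrable_EFinZ|exact: integrable_EFinZ].
    rewrite !RintegralZl// pdf1 -/v; field; rewrite gt_eqF//.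
  apply: le_Rintegral => //.
  - by apply: integrable_EFinD; exact: integrable_EFinZ.
  - exact: integrable_normal_pdf.
  - move=> x _; rewrite normal_pdf_scale//.
    rewrite mulrA -mulrDl ler_wpM2r ?normal_pdf_ge0//.
    have := expR_ge1Dx ((1 - r ^+ 2) * (x ^+ 2 / (s ^+ 2 *+ 2))).
    move=> /(ler_wpM2l (ltW r0)); apply: le_trans.
    by rewrite le_eqVlt; apply/orP; left; apply/eqP; ring.
set q := v / (s ^+ 2 *+ 2) in key.
suff q1 : q = 2^-1.
  have s2 : s ^+ 2 *+ 2 != 0 by rewrite gt_eqF// pmulrn_lgt0// exprn_gt0.
  by rewrite -[v](divfK s2) -/q q1; field.
(* Subtracting r in [key] leaves the factor 1 - r on both sides. Dividing by it reverses the
   inequality for r > 1, and both bounds tend to 2 q = 1. *)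
have key1 r : 0 < r < 1 -> r * (1 + r) * q <= 1.
  move=> /andP[r0 r1]; have r1' : 0 < 1 - r by lra.
  by rewrite -(ler_pM2l r1'); have := key r r0; nra.
have key2 r : 1 < r -> 1 <= r * (1 + r) * q.
  move=> r1; have r1' : 0 < r - 1 by lra.
  by rewrite -(ler_pM2l r1'); have := key r (lt_trans ltr01 r1); nra.
apply/eqP; rewrite eq_le; apply/andP; split; apply/ler_addgt0Pr => e e0.
- have [e1|e1] := ltP e 1; last first.
    by have := key1 2^-1; rewrite invr_gt0 ltr0n invf_lt1 ?ltr1n// => /(_ isT); lra.
  have := key1 (1 - e / 4); rewrite (_ : _ && _); last by apply/andP; split; lra.
  move=> /(_ isT); rewrite leNgt; apply: contraTT; rewrite -!ltNge => qe.
  have c0 : 0 < (1 - e / 4) * (1 + (1 - e / 4)) by nra.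
  apply/negPn; apply: le_lt_trans (_ : (1 - e / 4) * (1 + (1 - e / 4)) * (2^-1 + e) < _).
    by nra.
  by rewrite ltr_pM2l.
- have [e1|e1] := ltP e 1; last first.
    by have := key2 2; rewrite ltr1n => /(_ isT); lra.
  have := key2 (1 + e / 4); rewrite (_ : 1 < _); last by lra.
  move=> /(_ isT); rewrite leNgt; apply: contraTT; rewrite -!ltNge => qe.
  have c0 : 0 < (1 + e / 4) * (1 + (1 + e / 4)) by nra.
  apply/negPn.
  apply: lt_le_trans (_ : (1 + e / 4) * (1 + (1 + e / 4)) * (2^-1 - e) <= _).
    by rewrite ltr_pM2l//; lra.
  by nra.
Qed.

End normal_moments.

Section normal_law.
Context d (Omega : measurableType d) (R : realType) (P : probability Omega R).

Definition has_normal_law (s : R) (Z : {RV P >-> R}) :=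
  forall B : set R, measurable B -> P [set w | B (Z w)] = normal_prob 0 s B.

Variables (s : R).
Hypothesis s0 : 0 < s.

(* [R] carries two measurable structures with the same measurable sets but
   different displays, whence the detour through [measurableTypeR]. *)
Lemma ge0_integral_normal_law (Z : {RV P >-> R}) (f : R -> \bar R) :
  has_normal_law s Z ->
  measurable_fun setT f -> (forall x, 0 <= f x)%E ->
  (\int[P]_w f (Z w) = \int[normal_prob 0 s]_x f x)%E.
Proof.
move=> lawZ mf f0.
have mZ : measurable_fun setT (Z : Omega -> measurableTypeR R).
  exact: (@measurable_funPT _ _ _ _ Z).
have := @ge0_integral_pushforward _ _ _ _ R _ mZ P setT f measurableT mf.
rewrite preimage_setT => <- //.
by apply: eq_measure_integral => A mA _; exact: lawZ.
Qed.

Lemma Rintegral_sqr_normal_law (Z : {RV P >-> R}) :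
  has_normal_law s Z -> \int[P]_w (Z w ^+ 2) = s ^+ 2.
Proof.
move=> lawZ.
have m2 : measurable_fun setT (fun x : R => (x ^+ 2)%:E).
  by apply/measurable_EFinP; exact: measurable_funX.
have n2 x : (0 <= (x ^+ 2)%:E :> \bar R)%E by rewrite lee_fin sqr_ge0.
rewrite -(Rintegral_sqr_normal_pdf s0) /Rintegral.
by rewrite (ge0_integral_normal_law lawZ m2 n2) ge0_integral_normal_prob.
Qed.

(** The constant is chosen before [Z], so that all the increments of a grid share it. *)
Lemma L2le_sqr_normal_law : exists c, forall Z : {RV P >-> R},
  has_normal_law s Z -> L2le P (fun w => Z w ^+ 2) c.
Proof.
exists (Num.sqrt (\int[@lebesgue_measure R]_x (x ^+ 4 * normal_pdf 0 s x))).
move=> Z lawZ.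
have m4 : measurable_fun setT (fun x : R => (x ^+ 4)%:E).
  by apply/measurable_EFinP; exact: measurable_funX.
have n4 x : (0 <= (x ^+ 4)%:E :> \bar R)%E by rewrite lee_fin exprn_even_ge0.
split => //; first exact: measurable_funX.
rewrite sqr_sqrtr; last first.
  by apply: Rintegral_ge0 => x _; rewrite mulr_ge0 ?normal_pdf_ge0 ?exprn_even_ge0.
rewrite /Rintegral fineK; last first.
  by apply: integrable_fin_num => //; exact: integrable_fourth_normal_pdf.
under eq_integral do rewrite /= -exprM.
by rewrite (ge0_integral_normal_law lawZ m4 n4) ge0_integral_normal_prob.
Qed.

Lemma L2le_normal_law (Z : {RV P >-> R}) : has_normal_law s Z -> L2le P Z s.
Proof.
move=> lawZ; have [c /(_ _ lawZ) Zc] := L2le_sqr_normal_law.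
have Zi : P.-integrable setT (EFin \o (fun w => Z w ^+ 2)) := L2le_integrable Zc.
split => //; first exact: ltW.
by rewrite -(Rintegral_sqr_normal_law lawZ) fineK// integrable_fin_num.
Qed.

End normal_law.

(** * Independence from the past *)

Section independence.
Context d (Omega : measurableType d) (R : realType) (P : probability Omega R).

Definition independent (X Y : Omega -> R) := forall A B : set R,
  measurable A -> measurable B ->
  P (X @^-1` A `&` Y @^-1` B) = (P (X @^-1` A) * P (Y @^-1` B))%E.

Lemma independent_comp (X Y : Omega -> R) (f g : R -> R) :
  measurable_fun setT f -> measurable_fun setT g ->
  independent X Y -> independent (f \o X) (g \o Y).
Proof.
move=> mf mg XY A B mA mB; apply: (XY (f @^-1` A) (g @^-1` B)).
  by rewrite -[X in measurable X]setTI; exact: mf.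
by rewrite -[X in measurable X]setTI; exact: mg.
Qed.

(** Independence says that the law of the pair and the product of the laws agree on rectangles,
    hence everywhere. Tonelli then gives the integrability of the product and Fubini its mean. *)
Lemma independent_RintegralM_RV (X Y : {RV P >-> R}) : independent X Y ->
  P.-integrable setT (EFin \o X) -> P.-integrable setT (EFin \o Y) ->
  P.-integrable setT (EFin \o (fun w => X w * Y w)) /\
  \int[P]_w (X w * Y w) = \int[P]_w X w * \int[P]_w Y w.
Proof.
move=> XY iX iY.
have mXY : measurable_fun setT (fun w => (X w, Y w)).
  by apply/measurable_fun_pairP; split; exact: measurable_funPT.
pose V : {RV P >-> (R * R)%type} := mfun_Sub (mem_set mXY).
pose PX := distribution P X; pose PY := distribution P Y.
have VE S : measurable S -> (PX \x PY)%E S = distribution P V S.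
  apply: product_measure_unique => A B mA mB.
  exact: XY.
pose f (z : R * R) := (z.1 * z.2)%:E.
have mf : measurable_fun setT f.
  by apply/measurable_EFinP; apply: measurable_funM.
have mabs : measurable_fun setT (fun x : R => `|x|%:E).
  by apply/measurable_EFinP; exact: normr_measurable.
have xEX : (\int[PX]_x `|x%:E| = \int[P]_w `|(X w)%:E|)%E.
  by rewrite ge0_integral_distribution//; apply: measurableT_comp.
have yEY : (\int[PY]_x `|x%:E| = \int[P]_w `|(Y w)%:E|)%E.
  by rewrite ge0_integral_distribution//; apply: measurableT_comp.
have if' : (PX \x PY)%E.-integrable setT f.
  apply/integrable12ltyP => //.
  under eq_integral => x _.
    under eq_integral => y _ do rewrite /f /= normrM EFinM.
    rewrite ge0_integralZl//.
    rewrite yEY muleC; over.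
  rewrite /= ge0_integralZl//; last exact: integral_ge0.
  rewrite xEX lte_mul_pinfty ?integral_ge0//.
    by move/integrableP: iY => []; rewrite ge0_fin_numE ?integral_ge0.
  by move/integrableP: iX => [].
have iXY : P.-integrable setT (EFin \o (fun w => X w * Y w)).
  apply/integrableP; split; first exact/measurable_EFinP/measurable_funM.
  have <- := ge0_integral_distribution V
    (measurableT_comp (@abse_measurable R setT) mf) (fun=> abse_ge0 _).
  have -> : (\int[distribution P V]_y (abse \o f) y = \int[PX \x PY]_y (abse \o f) y)%E.
    by apply: eq_measure_integral => S mS _; apply/esym; exact: VE.
  by case/integrableP : if'.
split => //.
have iX' : PX.-integrable setT EFin.
  by apply/integrableP; split => //; rewrite xEX; case/integrableP: iX.
have iY' : PY.-integrable setT EFin.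
  by apply/integrableP; split => //; rewrite yEY; case/integrableP: iY.
have EX : (\int[PX]_x x%:E = \int[P]_w (X w)%:E)%E by rewrite integral_distribution.
have EY : (\int[PY]_x x%:E = \int[P]_w (Y w)%:E)%E by rewrite integral_distribution.
rewrite /Rintegral -fineM ?integrable_fin_num//; congr fine.
rewrite -EX -EY.
have <- := integral_distribution (X := V) mf iXY.
transitivity (\int[PX \x PY]_y f y)%E.
  by apply: eq_measure_integral => S mS _; apply/esym; exact: VE.
rewrite -integral12_prod_meas1//.
rewrite /fubini_F/=.
under eq_integral => x _.
  under eq_integral => y _ do rewrite /f /= EFinM.
  rewrite integralZl// -[X in (_ * X)%E]fineK ?integrable_fin_num// muleC; over.
rewrite /= integralZl// fineK ?integrable_fin_num//.
by rewrite muleC.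
Qed.

Lemma independent_RintegralM (X Y : Omega -> R) :
  measurable_fun setT X -> measurable_fun setT Y -> independent X Y ->
  P.-integrable setT (EFin \o X) -> P.-integrable setT (EFin \o Y) ->
  P.-integrable setT (EFin \o (fun w => X w * Y w)) /\
  \int[P]_w (X w * Y w) = \int[P]_w X w * \int[P]_w Y w.
Proof.
move=> mX mY XY iX iY.
exact: (@independent_RintegralM_RV (mfun_Sub (mem_set mX)) (mfun_Sub (mem_set mY))).
Qed.

(** As functions of A, both sides are finite measures; they agree on the pi-system [G], hence on the
    sigma-algebra that it generates. *)
Lemma g_sigma_algebra_independent (G : set (set Omega)) (B : set Omega) :
  G `<=` measurable -> setI_closed G -> G setT -> measurable B ->
  (forall A, G A -> P (A `&` B) = P A * P B)%E ->
  forall A, <<s G >> A -> (P (A `&` B) = P A * P B)%E.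
Proof.
move=> Gm GI GT mB GB A GA.
have PB0 : 0 <= fine (P B) by exact: fine_ge0.
pose m2 : {measure set Omega -> \bar R} := mscale (NngNum PB0) P.
have m2E C : m2 C = (P C * P B)%E.
  by rewrite /m2 /= /mscale /= fineK ?fin_num_measure// muleC.
rewrite -m2E -[LHS]/(mrestr P mB A).
apply: (g_sigma_algebra_measure_unique G Gm (fun=> setT)) => //.
- by rewrite bigcup_const//; exists 0%N.
- by move=> C GC; rewrite m2E -GB.
- by move=> _; rewrite /= /mrestr setTI (le_lt_trans (probability_le1 P mB))// ltry.
Qed.

End independence.

(** * Natural filtration of an independent sequence *)

Section past.
Context d (Omega : measurableType d) (R : realType) (P : probability Omega R).
Variable Z : nat -> {RV P >-> R}.
Hypothesis indepZ : forall k, mutually_independent P (fun i : 'I_k => Z i).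

Definition cylinder (j : nat) : set (set Omega) :=
  [set A | exists2 B : nat -> set R, (forall i, measurable (B i)) &
     A = \bigcap_(i < j) (Z i @^-1` B i)].

Lemma measurable_RV_preimage (i : nat) (B : set R) : measurable B ->
  measurable (Z i @^-1` B).
Proof.
by move=> mB; rewrite -[X in measurable X]setTI; exact: (@measurable_funPT _ _ _ _ (Z i)).
Qed.

Lemma cylinder_measurable j : cylinder j `<=` measurable.
Proof.
move=> _ [B mB ->]; apply: bigcap_measurableType => // i _.
exact: measurable_RV_preimage.
Qed.

Lemma cylinder_setI j : setI_closed (cylinder j).
Proof.
move=> _ _ [B mB ->] [C mC ->]; exists (fun i => B i `&` C i).
  by move=> i; exact: measurableI.
by rewrite -bigcapI; apply: eq_bigcapr => i _; rewrite preimage_setI.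
Qed.

Lemma cylinder_setT j : cylinder j setT.
Proof.
exists (fun=> setT) => //; apply/esym; rewrite -subTset => w _ i _ //.
Qed.

Lemma probability_cylinder (j : nat) (B : nat -> set R) :
  (forall i, measurable (B i)) ->
  P (\bigcap_(i < j) (Z i @^-1` B i)) = (\prod_(i < j) P (Z i @^-1` B i))%E.
Proof.
move=> mB; rewrite -(indepZ (B := fun i : 'I_j => B i))//; congr (P _).
apply/seteqP; split => w /= H i; first by move=> _; exact: (H i (ltn_ord i)).
by move=> ij; exact: (H (Ordinal ij)).
Qed.

(** Adaptedness to the natural filtration of [Z], indexed so that the past at time [j] stops at
    [Z (j - 1)] and leaves out [Z j]. *)
Definition past_measurable (j : nat) (f : Omega -> R) :=
  @measurable_fun _ _ (g_sigma_algebraType (cylinder j)) R setT f.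

Lemma past_measurableW j f : past_measurable j f -> measurable_fun setT f.
Proof.
move=> mf _ B mB.
apply: (smallest_sub (@sigma_algebra_measurable _ Omega) (@cylinder_measurable j)).
exact: mf.
Qed.

Lemma past_measurable_Z i j : (i < j)%N -> past_measurable j (Z i).
Proof.
move=> ij _ B mB; apply: sub_sigma_algebra; rewrite setTI.
exists (fun k => if k == i then B else setT); first by move=> k; case: ifP.
apply/seteqP; split => w /= H; last by have := H i ij; rewrite /= eqxx.
by move=> k _ /=; case: eqP => // ->.
Qed.

Lemma past_measurableS j f : past_measurable j f -> past_measurable j.+1 f.
Proof.
move=> mf _ B mB; apply: sub_smallest2r; [exact: smallest_sigma_algebra| |exact: mf].
move=> _ [C mC ->]; exists (fun k => if k == j then setT else C k).
  by move=> k; case: ifP.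
apply/seteqP; split => w /= H k /=.
  by rewrite ltnS leq_eqVlt => /orP[/eqP ->|kj]; [rewrite eqxx|case: eqP => // _; exact: H].
by move=> kj; have := H k (ltnW kj); rewrite /= ifN_eq// ltn_eqF.
Qed.

Lemma past_independent j f : past_measurable j f -> independent P f (Z j).
Proof.
move=> mf A B mA mB.
apply: (@g_sigma_algebra_independent _ _ _ _ (cylinder j)).
- exact: cylinder_measurable.
- exact: cylinder_setI.
- exact: cylinder_setT.
- exact: measurable_RV_preimage.
- move=> _ [C mC ->].
  (* With [B] as its constraint at rank [j], the intersection becomes a cylinder of length j + 1, to
     which the product rule applies. *)
  pose C' i := if i == j then B else C i.
  have mC' i : measurable (C' i) by rewrite /C'; case: ifP.
  have := probability_cylinder j.+1 mC'; rewrite big_ord_recr/= {3}/C' eqxx.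
  have -> : \bigcap_(i < j) Z i @^-1` C i = \bigcap_(i < j) Z i @^-1` C' i.
    by apply: eq_bigcapr => i /= ij; rewrite /C' ltn_eqF.
  rewrite -probability_cylinder// => <-; congr (P _).
  apply/seteqP; split => w /=.
    move=> [H1 H2] i /=; rewrite ltnS leq_eqVlt => /orP[/eqP ->|]; last exact: H1.
    by rewrite /C' eqxx.
  move=> H; split; first by move=> i ij; apply: H; exact: ltnW.
  by have := H j (ltnSn j); rewrite /= /C' eqxx.
- by rewrite -[X in <<s _ >> X]setTI; exact: mf.
Qed.

End past.

(** * Autoregressions with independent noise *)

Section autoregression.
Context d (Omega : measurableType d) (R : realType) (P : probability Omega R).
Variables (Z : nat -> {RV P >-> R}) (a s c : R).
Hypothesis indepZ : forall k, mutually_independent P (fun i : 'I_k => Z i).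
Hypothesis Z0 : forall i, \int[P]_w Z i w = 0.
Hypothesis Z2 : forall i, \int[P]_w (Z i w ^+ 2) = s ^+ 2.
Hypothesis L2Z : forall i, L2le P (Z i) s.
Hypothesis L4Z : forall i, L2le P (fun w => Z i w ^+ 2) c.
Hypotheses (a0 : 0 <= a) (a1 : a < 1).

Fixpoint ar (j : nat) : Omega -> R :=
  if j is i.+1 then fun w => a * ar i w + Z i w else cst 0.

(** Each term is what remains of the squared recursion without a^2 eta_i^2 and the mean s^2 of the
    squared noise: a cross term and a centred square. *)
Definition ar_martingale (j : nat) (w : Omega) : R :=
  \sum_(i < j) (2 * a * (ar i w * Z i w) + (Z i w ^+ 2 - s ^+ 2)).

Lemma ar_energy (n : nat) (w : Omega) :
  (1 - a ^+ 2) * \sum_(j < n) ar j w ^+ 2 =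
  n%:R * s ^+ 2 - ar n w ^+ 2 + ar_martingale n w.
Proof.
elim: n => [|n IHn]; first by rewrite /ar_martingale !big_ord0 /=; ring.
rewrite /ar_martingale !big_ord_recr/= -/(ar_martingale n w) mulrDr IHn.
by rewrite -(natr1 n); ring.
Qed.

Lemma past_measurable_ar j : past_measurable Z j (ar j).
Proof.
elim: j => [|j IHj] /=; first exact: measurable_cst.
apply: measurable_funD; last exact: past_measurable_Z.
by apply: measurable_funM; [exact: measurable_cst|exact: past_measurableS].
Qed.

Lemma past_measurable_ar_martingale j : past_measurable Z j (ar_martingale j).
Proof.
elim: j => [|j IHj].
  rewrite (_ : ar_martingale 0 = cst 0); first exact: measurable_cst.
  by apply/funext => w; rewrite /ar_martingale big_ord0.
rewrite (_ : ar_martingale _ = fun w => ar_martingale j w +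
    (2 * a * (ar j w * Z j w) + (Z j w ^+ 2 - s ^+ 2))); last first.
  by apply/funext => w; rewrite /ar_martingale big_ord_recr.
have mZ : past_measurable Z j.+1 (Z j) by exact: past_measurable_Z.
apply: measurable_funD; first exact: past_measurableS.
apply: measurable_funD; last by apply: measurable_funB => //; exact: measurable_funX.
apply: measurable_funM => //; apply: measurable_funM => //.
by apply: past_measurableS; exact: past_measurable_ar.
Qed.

(** The fixed point of x = a x + s, hence an L^2 bound of [ar] that is uniform in time. *)
Let b := s / (1 - a).

Let s0 : 0 <= s. Proof. by case: (L2Z 0). Qed.
Let c0 : 0 <= c. Proof. by case: (L4Z 0). Qed.
Let b0 : 0 <= b. Proof. by rewrite divr_ge0// subr_ge0 ltW. Qed.

Lemma L2le_ar j : L2le P (ar j) b.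
Proof.
elim: j => [|j IHj] /=.
  by apply: L2le_le (L2le_cst P 0); rewrite normr0.
apply: L2le_le (L2leD (L2leZ a IHj) (L2Z j)).
rewrite ger0_norm// /b le_eqVlt; apply/orP; left; apply/eqP.
by field; rewrite subr_eq0 gt_eqF.
Qed.

(** A product of two L^2 variables is in general only in L^1; here the squares are independent, so
    the second moment factorises. *)
Lemma L2le_ar_increment j : L2le P (fun w => ar j w * Z j w) (b * s).
Proof.
have par := @past_measurable_ar j.
have mar := past_measurableW par.
have ind : independent P (fun w => ar j w ^+ 2) (fun w => Z j w ^+ 2).
  apply: (independent_comp (f := fun x => x ^+ 2) (g := fun x => x ^+ 2)).
  - exact: measurable_funX.
  - exact: measurable_funX.
  - exact: past_independent.
have mar2 : measurable_fun setT (fun w => ar j w ^+ 2) by exact: measurable_funX.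
have mZ2 : measurable_fun setT (fun w => Z j w ^+ 2) by exact: measurable_funX.
have [] := independent_RintegralM mar2 mZ2 ind (L2le_integrable_sqr (L2le_ar j))
  (L2le_integrable_sqr (L2Z j)).
move=> i1 i2; split.
- exact: measurable_funM.
- exact: mulr_ge0.
under eq_integral do rewrite exprMn.
rewrite -[leLHS]fineK ?integrable_fin_num// lee_fin.
rewrite [leLHS]i2 Z2 exprMn ler_wpM2r ?sqr_ge0//.
exact: L2le_Rintegral (L2le_ar j).
Qed.

Let k := 2 * a * (b * s) + (c + s ^+ 2).
Let k0 : 0 <= k.
Proof.
apply: addr_ge0; last by apply: addr_ge0 => //; exact: sqr_ge0.
by apply: mulr_ge0; apply: mulr_ge0.
Qed.

(** The increment [D] is orthogonal to [M], because [Z n] and its centred square have mean zero and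
    are independent of the past. By Pythagoras the second moments add up, each increment
    contributing at most k^2. *)
Lemma L2le_ar_martingale n : L2le P (ar_martingale n) (Num.sqrt n%:R * k).
Proof.
elim: n => [|n IHn].
  rewrite sqrtr0 mul0r.
  apply: L2le_eq (L2le_le _ (L2le_cst P 0)); last by rewrite normr0.
  by move=> w; rewrite /ar_martingale big_ord0.
set M := ar_martingale n in IHn *.
pose D w := 2 * a * (ar n w * Z n w) + (Z n w ^+ 2 - s ^+ 2).
have M1 : ar_martingale n.+1 = (fun w => M w + D w).
  by apply/funext => w; rewrite /M /ar_martingale big_ord_recr.
have LD : L2le P D k.
  apply: L2le_le (L2leD (L2leZ (2 * a) (L2le_ar_increment n))
    (L2leB (L4Z n) (L2le_cst P (s ^+ 2)))).
  by rewrite /k !ger0_norm ?sqr_ge0// mulr_ge0.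
have pM := @past_measurable_ar_martingale n; rewrite -/M in pM.
have pA := @past_measurable_ar n.
have iMA : P.-integrable setT (EFin \o (fun w => M w * ar n w)).
  exact: L2le_integrableM IHn (L2le_ar n).
have pMA : past_measurable Z n (fun w => M w * ar n w) by exact: measurable_funM.
have iZ : P.-integrable setT (EFin \o Z n) := L2le_integrable (L2Z n).
have iM : P.-integrable setT (EFin \o M) := L2le_integrable IHn.
have iZ2 : P.-integrable setT (EFin \o (fun w => Z n w ^+ 2 - s ^+ 2)).
  exact: L2le_integrable (L2leB (L4Z n) (L2le_cst P (s ^+ 2))).
(* The product of [M] and [ar n] is treated as one integrable variable of the past; independence
   from [Z n] also yields the integrability of the triple product. *)
have [i1 e1] := independent_RintegralM (past_measurableW pMA)
  (measurable_funPT (Z n)) (past_independent indepZ pMA) iMA iZ.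
have mZ2 : measurable_fun setT (fun w => Z n w ^+ 2 - s ^+ 2).
  by apply: measurable_funB => //; exact: measurable_funX.
have indM : independent P M (fun w => Z n w ^+ 2 - s ^+ 2).
  apply: (independent_comp (f := id) (g := fun x => x ^+ 2 - s ^+ 2)) => //.
    by apply: measurable_funB => //; exact: measurable_funX.
  exact: past_independent.
have [i2 e2] := independent_RintegralM (past_measurableW pM) mZ2 indM iM iZ2.
have MD : \int[P]_w (M w * D w) = 0.
  transitivity (\int[P]_w (2 * a * (M w * ar n w * Z n w) + M w * (Z n w ^+ 2 - s ^+ 2))).
    by apply: eq_Rintegral => w _; rewrite /D; ring.
  rewrite RintegralD//; last exact: integrable_EFinZ.
  rewrite RintegralZl// e1 e2 Z0 mulr0 mulr0 RintegralB//; last 2 first.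
  - exact: L2le_integrable_sqr (L2Z n).
  - exact: L2le_integrable (L2le_cst P (s ^+ 2)).
  by rewrite Z2 Rintegral_probability_cst subrr mulr0 addr0.
have iM2 := L2le_integrable_sqr IHn; have iD2 := L2le_integrable_sqr LD.
have iMD := L2le_integrableM IHn LD.
have LM1 := L2leD IHn LD.
split.
- by rewrite M1; case: LM1.
- by rewrite mulr_ge0 ?sqrtr_ge0.
rewrite M1.
rewrite -[leLHS]fineK; last exact: integrable_fin_num (L2le_integrable_sqr LM1).
rewrite lee_fin -/(Rintegral _ _ _).
rewrite (_ : \int[P]_w _ = \int[P]_w (M w ^+ 2 + D w ^+ 2 + 2 * (M w * D w))); last first.
  by apply: eq_Rintegral => w _; ring.
rewrite RintegralD//; [|exact: integrable_EFinD|exact: integrable_EFinZ].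
rewrite RintegralZl// MD mulr0 addr0 RintegralD//.
apply: le_trans (lerD (L2le_Rintegral IHn) (L2le_Rintegral LD)) _.
by rewrite !exprMn !sqr_sqrtr ?ler0n// -(natr1 n) mulrDl mul1r.
Qed.

End autoregression.

(** * Wiener isometry *)

(* [(c, s, t)] stands for [c] times the increment over [s, t]. *)
Definition increment_comb (R : realType) (T : Type) (X : R -> T -> R)
    (r : seq (R * R * R)) (w : T) : R :=
  \sum_(x <- r) x.1.1 * (X x.2 w - X x.1.2 w).

Lemma increment_comb_cat (R : realType) (T : Type) (X : R -> T -> R) r1 r2 w :
  increment_comb X (r1 ++ r2) w = increment_comb X r1 w + increment_comb X r2 w.
Proof. exact: big_cat. Qed.

Lemma increment_comb1 (R : realType) (T : Type) (X : R -> T -> R) x w :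
  increment_comb X [:: x] w = x.1.1 * (X x.2 w - X x.1.2 w).
Proof. exact: big_seq1. Qed.

Section brownian_isometry.
Context d (T : measurableType d) (R : realType).
Variable mu : {measure set T -> \bar R}.

Lemma Rintegral_sum (I : Type) (r : seq I) (F : I -> T -> R) :
  (forall i, mu.-integrable setT (EFin \o F i)) ->
  mu.-integrable setT (EFin \o (fun x => \sum_(i <- r) F i x)) /\
  \int[mu]_x (\sum_(i <- r) F i x) = \sum_(i <- r) \int[mu]_x F i x.
Proof.
move=> iF; elim: r => [|i r [IH1 IH2]].
  under eq_fun do rewrite big_nil.
  split; last by rewrite big_nil /Rintegral integral0.
  by apply: eq_integrable (integrable0 _ _).
under eq_fun do rewrite big_cons.
split; first exact: integrable_EFinD.
by rewrite RintegralD// IH2 big_cons.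
Qed.

Variable X : R -> T -> R.
Hypothesis mX : forall t, measurable_fun setT (X t).
Hypothesis iX : forall s t, s <= t ->
  mu.-integrable setT (EFin \o (fun x => (X t x - X s x) ^+ 2)).
Hypothesis X2 : forall s t, s <= t -> \int[mu]_x ((X t x - X s x) ^+ 2) = t - s.

(** The polarised form of E (X_t - X_s)^2 = |t - s|. For two intervals with ordered ends it is the
    product of the coefficients by the length of the overlap. *)
Definition increment_cov (x y : R * R * R) : R :=
  x.1.1 * y.1.1 * 2^-1 * (`|x.2 - y.1.2| + `|x.1.2 - y.2| -
                          `|x.2 - y.2| - `|x.1.2 - y.1.2|).

Lemma increment_sqr s t :
  mu.-integrable setT (EFin \o (fun x => (X t x - X s x) ^+ 2)) /\
  \int[mu]_x ((X t x - X s x) ^+ 2) = `|t - s|.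
Proof.
have [st|/ltW ts] := leP s t.
  by split; [exact: iX|rewrite X2// ger0_norm// subr_ge0].
under eq_fun do rewrite -opprB sqrrN.
by split; [exact: iX|rewrite X2// distrC ger0_norm// subr_ge0].
Qed.

(* The product of two increments is a combination of four squared increments:
   [2 (p - q) (u - v) = (p - v)^2 + (q - u)^2 - (p - u)^2 - (q - v)^2]. *)
Lemma increment_mul (x y : R * R * R) :
  mu.-integrable setT (EFin \o (fun w => x.1.1 * (X x.2 w - X x.1.2 w) *
    (y.1.1 * (X y.2 w - X y.1.2 w)))) /\
  \int[mu]_w (x.1.1 * (X x.2 w - X x.1.2 w) * (y.1.1 * (X y.2 w - X y.1.2 w))) =
  increment_cov x y.
Proof.
have E w : x.1.1 * (X x.2 w - X x.1.2 w) * (y.1.1 * (X y.2 w - X y.1.2 w)) =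
  x.1.1 * y.1.1 * 2^-1 * ((X x.2 w - X y.1.2 w) ^+ 2 + (X x.1.2 w - X y.2 w) ^+ 2 +
  (- 1 * (X x.2 w - X y.2 w) ^+ 2 + - 1 * (X x.1.2 w - X y.1.2 w) ^+ 2)) by field.
have [i1 e1] := increment_sqr y.1.2 x.2; have [i2 e2] := increment_sqr y.2 x.1.2.
have [i3 e3] := increment_sqr y.2 x.2; have [i4 e4] := increment_sqr y.1.2 x.1.2.
under eq_fun do rewrite E.
have i12 := integrable_EFinD i1 i2.
have i34 := integrable_EFinD (integrable_EFinZ (- 1) i3) (integrable_EFinZ (- 1) i4).
split; first by apply: integrable_EFinZ; exact: integrable_EFinD.
rewrite RintegralZl//; last exact: integrable_EFinD.
rewrite RintegralD// RintegralD// RintegralD//; try exact: integrable_EFinZ.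
by rewrite !RintegralZl// e1 e2 e3 e4 /increment_cov; ring.
Qed.

(** The right-hand side depends on [r] alone, neither on [X] nor on [mu]: this is the isometry
    between any two families whose increments have these second moments. *)
Lemma increment_comb_sqr (r : seq (R * R * R)) :
  mu.-integrable setT (EFin \o (fun w => increment_comb X r w ^+ 2)) /\
  \int[mu]_w (increment_comb X r w ^+ 2) =
  \sum_(x <- r) \sum_(y <- r) increment_cov x y.
Proof.
have E w : increment_comb X r w ^+ 2 = \sum_(x <- r) \sum_(y <- r)
    (x.1.1 * (X x.2 w - X x.1.2 w) * (y.1.1 * (X y.2 w - X y.1.2 w))).
  by rewrite expr2 /increment_comb big_distrlr.
under eq_fun do rewrite E.
have key x : mu.-integrable setT (EFin \o (fun w => \sum_(y <- r)
    (x.1.1 * (X x.2 w - X x.1.2 w) * (y.1.1 * (X y.2 w - X y.1.2 w))))) /\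
    \int[mu]_w (\sum_(y <- r)
    (x.1.1 * (X x.2 w - X x.1.2 w) * (y.1.1 * (X y.2 w - X y.1.2 w)))) =
    \sum_(y <- r) increment_cov x y.
  have [i1 ->] := Rintegral_sum r (fun y => (increment_mul x y).1).
  by split => //; apply: eq_bigr => y _; exact: (increment_mul x y).2.
have [i1 ->] := Rintegral_sum r (fun x => (key x).1).
by split => //; apply: eq_bigr => x _; exact: (key x).2.
Qed.

Lemma measurable_increment_comb r : measurable_fun setT (increment_comb X r).
Proof.
rewrite /increment_comb; elim: r => [|x r IH].
  by under eq_fun do rewrite big_nil; exact: measurable_cst.
under eq_fun do rewrite big_cons.
by apply: measurable_funD => //; apply: measurable_funM => //; exact: measurable_funB.
Qed.

Lemma L2le_increment_comb r c : 0 <= c ->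
  L2le mu (increment_comb X r) c <->
  \sum_(x <- r) \sum_(y <- r) increment_cov x y <= c ^+ 2.
Proof.
move=> c0; have [i1 <-] := increment_comb_sqr r.
have -> : (\int[mu]_w (increment_comb X r w ^+ 2) <= c ^+ 2) =
    (\int[mu]_w (increment_comb X r w ^+ 2)%:E <= (c ^+ 2)%:E)%E.
  by rewrite -lee_fin fineK// integrable_fin_num.
by split => [[]//|]; split => //; exact: measurable_increment_comb.
Qed.

End brownian_isometry.

Section wiener_integral.
Context (R : realType) d (Omega : measurableType d) (P : probability Omega R).
Variable W : R -> {RV P >-> R}.
Hypothesis hW : two_sided_wiener W.
Notation lam := (@lebesgue_measure R).

Lemma wiener_increment_normal (s t : R) : s < t ->
  has_normal_law (P := P) (Num.sqrt (t - s)) (W t \- W s).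
Proof. by move=> st B mB; exact: (wiener_normal_increments hW). Qed.

Lemma wiener_increment_sqr (s t : R) : s <= t ->
  P.-integrable setT (EFin \o (fun w => (W t w - W s w) ^+ 2)) /\
  \int[P]_w ((W t w - W s w) ^+ 2) = t - s.
Proof.
rewrite le_eqVlt => /predU1P[->|st].
  under eq_fun do rewrite subrr expr0n/=.
  rewrite subrr Rintegral_probability_cst; split => //.
  by apply: eq_integrable (integrable0 _ _).
have ts0 : 0 < Num.sqrt (t - s) by rewrite sqrtr_gt0 subr_gt0.
have WN := wiener_increment_normal st.
split; first exact: L2le_integrable_sqr (L2le_normal_law ts0 WN).
by rewrite (Rintegral_sqr_normal_law ts0 WN) sqr_sqrtr// subr_ge0 ltW.
Qed.

(* The increments of [half_line] are the indicators of the intervals ]s, t], with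
   the same covariances as those of [W]. *)
Definition half_line (t : R) : R -> R := \1_`]-oo, t].

Lemma half_lineB (s t x : R) : s <= t -> half_line t x - half_line s x = \1_`]s, t] x.
Proof.
move=> st; rewrite /half_line !indicE !mem_setE !in_itv/=.
have [xs|sx] := leP x s; first by rewrite (le_trans xs st) subrr.
by rewrite subr0.
Qed.

Lemma measurable_half_line t : measurable_fun setT (half_line t).
Proof. exact: measurable_indic. Qed.

Lemma half_lineB_sqr (s t : R) : s <= t ->
  lam.-integrable setT (EFin \o (fun x => (half_line t x - half_line s x) ^+ 2)) /\
  \int[lam]_x ((half_line t x - half_line s x) ^+ 2) = t - s.
Proof.
move=> st.
have E x : (half_line t x - half_line s x) ^+ 2 = \1_`]s, t] x.
  by rewrite half_lineB// indicE; case: (_ \in _); rewrite ?expr1n ?expr0n.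
have L : (\int[lam]_x (\1_`]s, t] x)%:E = (t - s)%:E)%E.
  rewrite integral_indic// setIT [LHS](@lebesgue_measure_itv R `]s, t])/= lte_fin.
  by case: ltP => //; move: st; rewrite le_eqVlt => /predU1P[->|/lt_geF ->//]; rewrite subrr.
under eq_fun do rewrite E.
split; last by rewrite /Rintegral L.
apply/integrableP; split; first exact/measurable_EFinP/measurable_indic.
by under eq_integral do rewrite /= ger0_norm//; rewrite L ltry.
Qed.

Definition step_increments (k : R) (phi : step_function R) : seq (R * R * R) :=
  [seq (k * sf_coef phi (val i), sf_pt phi (val i), sf_pt phi (val i).+1)
  | i <- index_enum 'I_(sf_size phi)].

Lemma step_funE k phi x :
  k * step_fun phi x = increment_comb half_line (step_increments k phi) x.
Proof.
rewrite /increment_comb /step_increments big_map /step_fun mulr_sumr.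
by apply: eq_bigr => i _ /=; rewrite half_lineB ?mulrA// sf_pt_homo.
Qed.

Lemma step_wiener_integralE k phi w :
  k * step_wiener_integral W phi w = increment_comb W (step_increments k phi) w.
Proof.
rewrite /increment_comb /step_increments big_map /step_wiener_integral mulr_sumr.
by apply: eq_bigr => i _ /=; rewrite mulrA.
Qed.

Lemma increment_comb_isometry r c :
  L2le lam (increment_comb half_line r) c -> L2le P (increment_comb W r) c.
Proof.
move=> H; have c0 : 0 <= c by case: H.
have h1 s t st := (@half_lineB_sqr s t st).1.
have h2 s t st := (@half_lineB_sqr s t st).2.
have w1 s t st := (@wiener_increment_sqr s t st).1.
have w2 s t st := (@wiener_increment_sqr s t st).2.
have mW t : measurable_fun setT (W t) by exact: measurable_funPT.
apply/(L2le_increment_comb mW w1 w2 r c0).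
exact: (@L2le_increment_comb _ _ R lam half_line measurable_half_line h1 h2 r c c0).1 H.
Qed.

Lemma L2le_step_wiener_integral phi : exists c, L2le P (step_wiener_integral W phi) c.
Proof.
rewrite (_ : step_wiener_integral W phi = increment_comb W (step_increments 1 phi)); last first.
  by apply/funext => w; rewrite -step_wiener_integralE mul1r.
apply: integrable_L2le; first by apply: measurable_increment_comb => t; exact: measurable_funPT.
apply: (increment_comb_sqr _ _ _).1.
- by move=> s t st; exact: (wiener_increment_sqr st).1.
- by move=> s t st; exact: (wiener_increment_sqr st).2.
Qed.

(** One and the same step function serves on the line and on the probability space, so that the
    exact isometry of step functions can be inserted between the two errors. *)
Lemma wiener_integral_approx (f : R -> R) (I : {RV P >-> R}) (e : R) :
  measurable_fun setT f -> is_wiener_integral W f I -> 0 < e ->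
  exists phi, L2le lam (fun x => f x - step_fun phi x) e /\
              L2le P (fun w => I w - step_wiener_integral W phi w) e.
Proof.
move=> mf [phi [fphi Iphi]] e0.
have near_le (u : nat -> \bar R) : u @ \oo --> 0%E ->
    \forall n \near \oo, (u n <= e%:E)%E.
  move=> /fine_cvgP[ufin /cvgr0_norm_lt/(_ _ e0) ue].
  near=> n; have un : u n \is a fin_num by near: n.
  rewrite -(fineK un) lee_fin ltW// (le_lt_trans (ler_norm _))//.
  by near: n.
have [n [fn In]] := @filter_ex _ _ _ _ (filterI (near_le _ fphi) (near_le _ Iphi)).
have mS : measurable_fun setT (step_fun (phi n)).
  rewrite (_ : step_fun (phi n) = increment_comb half_line (step_increments 1 (phi n))).
    by apply: measurable_increment_comb; exact: measurable_half_line.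
  by apply/funext => x; rewrite -step_funE mul1r.
have [c [mSW _ _]] := L2le_step_wiener_integral (phi n).
exists (phi n); split; apply/L2leP => //; try exact: ltW.
  exact: measurable_funB.
exact: measurable_funB.
Unshelve. all: by end_near. Qed.

Lemma L2le_wiener_integral (f : R -> R) (I : {RV P >-> R}) :
  measurable_fun setT f -> is_wiener_integral W f I -> exists c, L2le P I c.
Proof.
move=> mf If; have [phi [_ H]] := wiener_integral_approx mf If ltr01.
have [c Sc] := L2le_step_wiener_integral phi.
exists (1 + c); apply: L2le_eq (L2leD H Sc) => w; exact: subrK.
Qed.

(** The two approximating step functions and the increment over [s, t] are merged into a single
    combination [r], to which the isometry applies. The approximation error is paid twice, on the
    line and on the probability space. *)
Lemma wiener_integral_isometry (f g : R -> R) (I J : {RV P >-> R}) (a s t c : R) :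
  measurable_fun setT f -> measurable_fun setT g ->
  is_wiener_integral W f I -> is_wiener_integral W g J -> s <= t ->
  L2le lam (fun x => f x - a * g x - \1_`]s, t] x) c ->
  L2le P (fun w => I w - a * J w - (W t w - W s w)) c.
Proof.
move=> mf mg If Jg st H; have c0 : 0 <= c by case: H.
apply: L2le_eps => // e e0.
(* Chosen so that the errors of [I] and of a times [J] add up to e / 2. *)
pose e' := e / (2 * (1 + `|a|)).
have a0 : 0 < 1 + `|a| by rewrite ltr_wpDr.
have e'0 : 0 < e' by rewrite divr_gt0// mulr_gt0.
have [phi [fphi Iphi]] := wiener_integral_approx mf If e'0.
have [psi [gpsi Jpsi]] := wiener_integral_approx mg Jg e'0.
pose r := step_increments 1 phi ++ step_increments (- a) psi ++ [:: (- 1, s, t)].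
have e'E : e' + `|a| * e' = e / 2.
  by rewrite /e'; field; rewrite gt_eqF.
have Hr : L2le lam (increment_comb half_line r) (c + e / 2).
  apply: L2le_le (L2le_eq _ (L2leD H (L2leD (L2leN fphi) (L2leZ a gpsi)))).
    by rewrite e'E.
  move=> x; rewrite /r !increment_comb_cat increment_comb1/=.
  by rewrite -!step_funE half_lineB//; ring.
apply: L2le_le (L2le_eq _ (L2leD (increment_comb_isometry Hr) (L2leB Iphi (L2leZ a Jpsi)))).
  by rewrite e'E; lra.
move=> w; rewrite /r !increment_comb_cat increment_comb1/=.
by rewrite -!step_wiener_integralE; ring.
Qed.

Variables (theta : R) (xi : R -> {RV P >-> R}).
Hypothesis theta0 : 0 < theta.
Hypothesis hxi : ornstein_uhlenbeck theta W xi.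

Definition ou_kernel (t s : R) : R := \1_`]-oo, t] s * expR (- (theta * (t - s))).

Lemma measurable_ou_kernel t : measurable_fun setT (ou_kernel t).
Proof.
apply: measurable_funM; first exact: measurable_indic.
apply: measurableT_comp => //; apply: measurableT_comp => //.
by apply: measurable_funM => //; exact: measurable_funB.
Qed.

Lemma L2le_indic_itv (s t : R) : s <= t -> L2le lam \1_`]s, t] (Num.sqrt (t - s)).
Proof.
move=> st; have [i1 e1] := half_lineB_sqr st.
suff H : L2le lam (fun x => half_line t x - half_line s x) (Num.sqrt (t - s)).
  by apply: L2le_eq H => x; rewrite half_lineB.
split.
- by apply: measurable_funB; exact: measurable_half_line.
- exact: sqrtr_ge0.
- by rewrite sqr_sqrtr ?subr_ge0// -e1 fineK// integrable_fin_num.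
Qed.

(** On ]-oo, s] the two kernels cancel exactly; on ]s, t] there remains exp(- theta (t - x)) - 1, of
    size at most theta (t - s). *)
Lemma ou_kernel_step (s t : R) : s <= t ->
  L2le lam (fun x => ou_kernel t x - expR (- (theta * (t - s))) * ou_kernel s x -
                     \1_`]s, t] x) (theta * (t - s) * Num.sqrt (t - s)).
Proof.
move=> st; have th : 0 <= theta * (t - s) by rewrite mulr_ge0 ?subr_ge0// ltW.
rewrite -{2}(ger0_norm th); apply: le_L2le (L2leZ _ (L2le_indic_itv st)).
  apply: measurable_funB; last exact: measurable_indic.
  apply: measurable_funB; first exact: measurable_ou_kernel.
  by apply: measurable_funM => //; exact: measurable_ou_kernel.
move=> x; rewrite /ou_kernel !indicE !mem_setE !in_itv/=.
have [xs|sx] := leP x s.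
  rewrite (le_trans xs st)/= !mul1r -expRD.
  rewrite (_ : - (theta * (t - s)) + _ = - (theta * (t - x))); last by ring.
  by rewrite subrr subr0 normr0 normr_ge0.
rewrite mul0r mulr0 subr0/=.
have [xt|tx] := leP x t; last by rewrite mul0r subr0 normr0 normr_ge0.
rewrite mul1r mulr1 (ger0_norm th) ler0_norm; last first.
  by rewrite subr_le0 -expR0 ler_expR oppr_le0 mulr_ge0 ?subr_ge0// ltW.
rewrite opprB mulr1n; have := expR_ge1Dx (- (theta * (t - x))).
have : theta * (t - x) <= theta * (t - s) by rewrite ler_pM2l//; lra.
lra.
Qed.

Lemma L2le_ou_step (s t : R) : s <= t ->
  L2le P (fun w => xi t w - expR (- (theta * (t - s))) * xi s w - (W t w - W s w))
    (theta * (t - s) * Num.sqrt (t - s)).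
Proof.
move=> st; apply: wiener_integral_isometry (ou_kernel_step st) => //.
- exact: measurable_ou_kernel.
- exact: measurable_ou_kernel.
- exact: (ou_wiener_integral hxi).
- exact: (ou_wiener_integral hxi).
Qed.

Lemma L2le_ou (t : R) : exists c, L2le P (xi t) c.
Proof.
exact: L2le_wiener_integral (measurable_ou_kernel t) (ou_wiener_integral hxi t).
Qed.

End wiener_integral.

(** * Law of large numbers along a grid *)

Section L1_bounds.
Context d (T : measurableType d) (R : realType).
Variable mu : {measure set T -> \bar R}.
Implicit Types (f g : T -> R).

Definition L1le f c := measurable_fun setT f /\ (\int[mu]_x (`|f x|)%:E <= c%:E)%E.

Lemma L1le_le f b c : b <= c -> L1le f b -> L1le f c.
Proof. by move=> bc [mf fb]; split => //; rewrite (le_trans fb)// lee_fin. Qed.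

Lemma L1le_eq f g c : f =1 g -> L1le f c -> L1le g c.
Proof. by move=> /funext ->. Qed.

Lemma L1leD f g a b : L1le f a -> L1le g b -> L1le (fun x => f x + g x) (a + b).
Proof.
move=> [mf fa] [mg gb]; split; first exact: measurable_funD.
have mnf : measurable_fun setT (fun x => (`|f x|)%:E).
  by apply/measurable_EFinP; exact: measurableT_comp.
have mng : measurable_fun setT (fun x => (`|g x|)%:E).
  by apply/measurable_EFinP; exact: measurableT_comp.
rewrite EFinD; apply: le_trans (leeD fa gb).
rewrite -ge0_integralD//; apply: ge0_le_integral => //.
- by apply/measurable_EFinP; apply: measurableT_comp => //; exact: measurable_funD.
- exact: emeasurable_funD.
- by move=> x _; rewrite -EFinD lee_fin ler_normD.
Qed.

Lemma L1leZ k f a : L1le f a -> L1le (fun x => k * f x) (`|k| * a).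
Proof.
move=> [mf fa]; split; first exact: measurable_funM.
under eq_integral do rewrite normrM EFinM.
rewrite ge0_integralZl_EFin//; last first.
  by apply/measurable_EFinP; exact: measurableT_comp.
by rewrite [leRHS]EFinM lee_wpmul2l// lee_fin.
Qed.

Lemma L1le_sum (n : nat) (F : nat -> T -> R) (c : nat -> R) :
  (forall i, (i < n)%N -> L1le (F i) (c i)) ->
  L1le (fun x => \sum_(i < n) F i x) (\sum_(i < n) c i).
Proof.
elim: n => [|n IH] H.
  under eq_fun do rewrite big_ord0; rewrite big_ord0; split; first exact: measurable_cst.
  by under eq_integral do rewrite normr0; rewrite integral0.
under eq_fun do rewrite big_ord_recr/=; rewrite big_ord_recr/=.
by apply: L1leD; [apply: IH => i ni; apply: H; exact: ltnW|exact: H].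
Qed.

Lemma L2le_L1leM f g a b : L2le mu f a -> L2le mu g b -> L1le (fun x => f x * g x) (a * b).
Proof.
move=> fa gb; split; last exact: L2le_mul fa gb.
by case: fa gb => mf _ _ [mg _ _]; exact: measurable_funM.
Qed.

Lemma L2le_L1le_sqrB f g a b c : L2le mu (fun x => f x - g x) a -> L2le mu f b ->
  L2le mu g c -> L1le (fun x => f x ^+ 2 - g x ^+ 2) (a * (b + c)).
Proof.
move=> fga fb gc; apply: L1le_eq (L2le_L1leM fga (L2leD fb gc)) => x.
by rewrite subr_sqr.
Qed.

End L1_bounds.

Section L1_probability.
Context d (T : measurableType d) (R : realType) (P : probability T R).

Lemma L2le_L1le (f : T -> R) c : L2le P f c -> L1le P f c.
Proof. by move=> fc; split; [case: fc|exact: L2le_integral]. Qed.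

Lemma L1le_cst (k : R) : L1le P (cst k) `|k|.
Proof. exact: L2le_L1le (L2le_cst P k). Qed.

(** The point is that the mean depends on the law only, so that all increments of a grid share it;
    [noise_mean] then finds its value. *)
Lemma normal_law_mean (s : R) (Z : {RV P >-> R}) : 0 < s ->
  has_normal_law s Z -> \int[P]_w Z w = \int[normal_prob 0 s]_x x.
Proof.
move=> s0 lawZ.
have mZ : measurable_fun setT (Z : T -> measurableTypeR R).
  exact: (@measurable_funPT _ _ _ _ Z).
have iZ : P.-integrable setT (EFin \o Z) := L2le_integrable (L2le_normal_law s0 lawZ).
congr fine.
transitivity (\int[pushforward P (Z : T -> measurableTypeR R)]_x x%:E)%E.
  rewrite (integral_pushforward mZ)//.
apply: eq_measure_integral => A mA _; exact: lawZ.
Qed.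

End L1_probability.

Lemma geometric_sum_le (R : realFieldType) (a : R) (n : nat) : 0 <= a -> a < 1 ->
  \sum_(j < n) a ^+ j <= (1 - a)^-1.
Proof.
move=> a0 a1; have b0 : 0 < 1 - a by rewrite subr_gt0.
rewrite -(ler_pM2l b0) mulfV ?gt_eqF// -opprB mulNr -subrX1 opprB.
by rewrite gerBl exprn_ge0.
Qed.

(** * Uniform L^2 bounds for the process and its increments *)

Section OU_bounds.
Context (R : realType) d (Omega : measurableType d) (P : probability Omega R).
Variables (W xi : R -> {RV P >-> R}) (theta : R).
Hypothesis hW : two_sided_wiener W.
Hypothesis theta0 : 0 < theta.
Hypothesis hxi : ornstein_uhlenbeck theta W xi.

Let decay (t : R) := expR (- (theta * t)).

Lemma decay_lt1 t : 0 < t -> decay t < 1.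
Proof. by move=> t0; rewrite /decay -expR0 ltr_expR oppr_lt0 mulr_gt0. Qed.

Lemma decay_ge t : 1 - theta * t <= decay t.
Proof. exact: expR_ge1Dx. Qed.

Lemma L2le_wiener_increment s t : s <= t -> L2le P (fun w => W t w - W s w) (Num.sqrt (t - s)).
Proof.
move=> st; have [i1 e1] := wiener_increment_sqr hW st; split.
- exact: measurable_funB.
- exact: sqrtr_ge0.
- by rewrite sqr_sqrtr ?subr_ge0// -e1 fineK// integrable_fin_num.
Qed.

Lemma L2le_ou_next (s t c : R) : s <= t <= s + 1 -> L2le P (xi s) c ->
  L2le P (xi t) (decay (t - s) * c + (1 + theta)).
Proof.
move=> /andP[st ts1] xc.
apply: L2le_le (L2le_eq _ (L2leD (L2le_ou_step hW theta0 hxi st)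
  (L2leD (L2leZ (decay (t - s)) xc) (L2le_wiener_increment st)))); last first.
  by move=> w; rewrite /decay; ring.
rewrite ger0_norm ?expR_ge0//.
have u0 : 0 <= Num.sqrt (t - s) by exact: sqrtr_ge0.
have u1 : Num.sqrt (t - s) <= 1 by rewrite -[leRHS]sqrtr1 ler_wsqrtr//; lra.
have : theta * (t - s) * Num.sqrt (t - s) <= theta.
  rewrite -[leRHS]mulr1 ler_pM ?mulr_ge0 ?subr_ge0//; first exact: ltW.
  by rewrite -[leRHS]mulr1 ler_pM2l//; lra.
lra.
Qed.

Lemma ou_bounded : exists C, forall t, 0 <= t -> L2le P (xi t) C.
Proof.
have [c xc] := L2le_ou hW hxi 0; have c0 : 0 <= c by case: xc.
have a1 := decay_lt1 ltr01.
have d0 : 0 < 1 - decay 1 by lra.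
(* Over a unit of time the norm undergoes the contraction x -> decay 1 * x + (1 + theta). Since C
   lies above its fixed point, a bound by C persists; the terms c and 1 + theta cover the initial
   interval [0, 1]. *)
pose C := c + (1 + theta) / (1 - decay 1) + (1 + theta).
have q0 : 0 <= (1 + theta) / (1 - decay 1).
  by apply: divr_ge0; [apply: addr_ge0 => //; exact: ltW|exact: ltW].
have C1 : decay 1 * C + (1 + theta) <= C.
  have : (1 - decay 1) * ((1 + theta) / (1 - decay 1)) = 1 + theta.
    by rewrite mulrC divfK// gt_eqF.
  have t0 : 0 <= 1 + theta by apply: addr_ge0 => //; exact: ltW.
  have := mulr_ge0 (ltW d0) c0; have := mulr_ge0 (ltW d0) t0.
  rewrite /C; move: ((1 + theta) / _) => q; lra.
have key n t : n%:R <= t <= n%:R + 1 -> L2le P (xi t) C.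
  elim: n t => [|n IH] t.
    move=> t1; apply: L2le_le (L2le_ou_next t1 xc).
    have : decay (t - 0) <= 1.
      rewrite /decay -[leRHS]expR0 ler_expR oppr_le0 mulr_ge0 ?subr0//; first exact: ltW.
      by case/andP: t1.
    rewrite /C; nra.
  rewrite -natr1 => /andP[nt tn].
  have t1 : t - 1 <= t <= t - 1 + 1 by apply/andP; split; lra.
  apply: L2le_le C1 _.
  have -> : decay 1 = decay (t - (t - 1)) by congr decay; ring.
  by apply: L2le_ou_next => //; apply: IH; apply/andP; split; lra.
exists C => t t0; apply: (key (Num.truncn t)).
by have := truncn_itv t0; rewrite -natr1 => /andP[-> /ltW ->].
Qed.

(** The terms theta C, 1 and theta come from the decay of [xi s], the increment of [W] and the error
    of [L2le_ou_step], each compared with sqrt(t - s). *)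
Lemma ou_increment (C s t : R) : L2le P (xi s) C -> 0 <= t - s <= 1 ->
  L2le P (fun w => xi t w - xi s w) ((theta * C + 1 + theta) * Num.sqrt (t - s)).
Proof.
move=> xC /andP[ts0 ts1]; have C0 : 0 <= C by case: xC.
have st : s <= t by rewrite -subr_ge0.
apply: L2le_le (L2le_eq _ (L2leD (L2le_ou_step hW theta0 hxi st)
  (L2leD (L2leZ (decay (t - s) - 1) xC) (L2le_wiener_increment st)))); last first.
  by move=> w; rewrite /decay; ring.
set u := Num.sqrt (t - s).
have u0 : 0 <= u by exact: sqrtr_ge0.
have u1 : u <= 1 by rewrite -[leRHS]sqrtr1 ler_wsqrtr//; lra.
have uE : t - s = u ^+ 2 by rewrite sqr_sqrtr.
have ule : t - s <= u by rewrite uE; nra.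
have d1 : `|decay (t - s) - 1| <= theta * u.
  have := decay_ge (t - s).
  have : decay (t - s) <= 1.
    by rewrite /decay -[leRHS]expR0 ler_expR oppr_le0 mulr_ge0// ltW.
  have : theta * (t - s) <= theta * u by rewrite ler_pM2l.
  by rewrite ler_norml => h1 h2 h3; apply/andP; split; lra.
have : `|decay (t - s) - 1| * C <= theta * u * C by rewrite ler_wpM2r.
have : theta * (t - s) * u <= theta * u.
  by rewrite ler_wpM2r//; have := ler_pM2l theta0 (t - s) 1; rewrite mulr1 ts1.
rewrite !mulrDl mul1r; lra.
Qed.

(** * Comparison with the autoregression on a grid *)

Section discretisation.
Variable delta : R.
Hypotheses (delta0 : 0 < delta) (delta1 : delta <= 1).

Definition grid (j : nat) : R := j%:R * delta.

Lemma grid_homo : {homo grid : i j / (i <= j)%N >-> i <= j}.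
Proof. by move=> i j ij; rewrite /grid ler_wpM2r ?ler_nat// ltW. Qed.

Lemma grid_ge0 j : 0 <= grid j.
Proof. by rewrite mulr_ge0// ltW. Qed.

Lemma gridS j : grid j.+1 = grid j + delta.
Proof. by rewrite /grid -natr1 mulrDl mul1r. Qed.

Lemma gridSB j : grid j.+1 - grid j = delta.
Proof. by rewrite gridS addrC addKr. Qed.

Definition noise (j : nat) : {RV P >-> R} := W (grid j.+1) \- W (grid j).

Lemma noise_independent k : mutually_independent P (fun i : 'I_k => noise i).
Proof.
exact: (@wiener_independent_increments _ _ _ _ _ hW k grid grid_homo).
Qed.

Let sd0 : 0 < Num.sqrt delta. Proof. by rewrite sqrtr_gt0. Qed.

Lemma noise_normal j : has_normal_law (Num.sqrt delta) (noise j).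
Proof.
have := @wiener_increment_normal _ _ _ _ _ hW (grid j) (grid j.+1).
by rewrite gridSB; apply; rewrite gridS ltrDl.
Qed.

(* Consecutive increments are uncorrelated, independent and of the same law, so
   that the square of their common mean vanishes. *)
Lemma noise_mean j : \int[P]_w noise j w = 0.
Proof.
have same i k : \int[P]_w noise i w = \int[P]_w noise k w.
  by rewrite !(normal_law_mean sd0 (noise_normal _)).
have iN i : P.-integrable setT (EFin \o noise i).
  exact: L2le_integrable (L2le_normal_law sd0 (noise_normal i)).
have [_ ind] := independent_RintegralM (measurable_funPT (noise 0))
  (measurable_funPT (noise 1))
  (past_independent noise_independent (@past_measurable_Z _ _ _ _ noise 0 1 isT)) (iN 0) (iN 1).
have w1 s t st := (@wiener_increment_sqr _ _ _ _ _ hW s t st).1.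
have w2 s t st := (@wiener_increment_sqr _ _ _ _ _ hW s t st).2.
have [_] := increment_mul w1 w2 (1, grid 0, grid 1) (1, grid 1, grid 2).
rewrite /increment_cov /= subrr normr0.
have -> : `|grid 0 - grid 2| = 2 * delta.
  by rewrite /grid mul0r sub0r normrN ger0_norm// mulr_ge0// ltW.
rewrite distrC gridSB (distrC (grid 0)) gridSB gtr0_norm//.
have -> : \int[P]_w (1 * (W (grid 1) w - W (grid 0) w) * (1 * (W (grid 2) w - W (grid 1) w))) =
    \int[P]_w (noise 0 w * noise 1 w).
  by apply: eq_Rintegral => w _; rewrite !mul1r.
rewrite ind (same 1%N 0%N) (same j 0%N) -expr2 => H.
by apply/eqP; rewrite -sqrf_eq0 H; apply/eqP; ring.
Qed.

Lemma noise_sqr j : \int[P]_w (noise j w ^+ 2) = Num.sqrt delta ^+ 2.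
Proof. by have := Rintegral_sqr_normal_law sd0 (noise_normal j). Qed.

Definition ou_ar (j : nat) : Omega -> R := ar noise (decay delta) j.

Lemma decay_delta : 0 <= decay delta < 1.
Proof. by rewrite expR_ge0 decay_lt1. Qed.

(** The error is multiplied by a and increased by theta delta^(3/2) at each step: the second term is
    the fixed point of this recursion, the first one the fading trace of [xi 0], as [ou_ar] starts
    at 0. *)
Lemma L2le_ou_ar C j : (forall t, 0 <= t -> L2le P (xi t) C) ->
  L2le P (fun w => xi (grid j) w - ou_ar j w)
    (decay delta ^+ j * C +
     theta * delta * Num.sqrt delta / (1 - decay delta)).
Proof.
move=> xC; have /andP[a0 a1] := decay_delta.
have b0 : 0 < 1 - decay delta by rewrite subr_gt0.
elim: j => [|j IH].
  apply: L2le_le (L2le_eq _ (xC (grid 0) (grid_ge0 0))); last first.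
    by move=> w; rewrite subr0.
  rewrite expr0 mul1r lerDl divr_ge0 ?ltW// mulr_gt0// mulr_gt0//.
have gg : grid j <= grid j.+1 by exact: grid_homo.
have := L2le_ou_step hW theta0 hxi gg; rewrite gridSB => st.
apply: L2le_le (L2le_eq _ (L2leD st (L2leZ (decay delta) IH))); last first.
  by move=> w; rewrite /ou_ar /= -/(decay delta) /noise /=; ring.
rewrite (ger0_norm a0) exprS le_eqVlt; apply/orP; left; apply/eqP; field.
by rewrite gt_eqF.
Qed.

Let r := theta * delta * Num.sqrt delta / (1 - decay delta).

(** From a (1 + theta delta) <= a exp(theta delta) = 1 follows theta delta <= (1 - a)(1 + theta
    delta). *)
Lemma discretisation_error_le : r <= (1 + theta) * Num.sqrt delta.
Proof.
have /andP[a0 a1] := decay_delta.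
have x0 : 0 < theta * delta by exact: mulr_gt0.
have ax : decay delta * (1 + theta * delta) <= 1.
  apply: le_trans (_ : decay delta * expR (theta * delta) <= _).
    by rewrite ler_wpM2l// expR_ge1Dx.
  by rewrite -expRD addNr expR0.
have xt : theta * delta <= theta by rewrite -[leRHS]mulr1 ler_pM2l.
have b0 : 0 < 1 - decay delta by rewrite subr_gt0.
rewrite /r ler_pdivrMr// [leRHS]mulrAC ler_wpM2r ?(ltW sd0)//.
have := mulr_ge0 (ltW b0) (_ : 0 <= theta - theta * delta); rewrite subr_ge0 => /(_ xt).
lra.
Qed.

(** With y = 2 theta delta, 1 - exp(- y) lies between y / (1 + y) and y, so the quotient lies
    between 1 / (2 theta) and (1 + y) / (2 theta), which is 1 / (2 theta) + delta. *)
Lemma asymptotic_variance_le :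
  `|delta / (1 - decay delta ^+ 2) - (2 * theta)^-1| <= delta.
Proof.
have /andP[a0 a1] := decay_delta.
set y := 2 * theta * delta.
have y0 : 0 < y by rewrite /y !mulr_gt0.
have aE : decay delta ^+ 2 = expR (- y).
  by rewrite /decay expr2 -expRD; congr expR; rewrite /y; ring.
rewrite aE.
have e1 : 1 - expR (- y) <= y by have := expR_ge1Dx (- y); lra.
have e2 : y <= (1 - expR (- y)) * (1 + y).
  have : expR (- y) * (1 + y) <= 1.
    apply: le_trans (_ : expR (- y) * expR y <= _).
      by rewrite ler_wpM2l ?expR_ge0// expR_ge1Dx.
    by rewrite -expRD addNr expR0.
  lra.
have u0 : 0 < 1 - expR (- y) by rewrite subr_gt0 -expR0 ltr_expR oppr_lt0.
have t0 : 0 < 2 * theta by rewrite mulr_gt0.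
have yE : y * (2 * theta)^-1 = delta by rewrite /y mulrAC mulfV ?mul1r// gt_eqF.
have p0 : 0 < (2 * theta)^-1 by rewrite invr_gt0.
rewrite ger0_norm.
  rewrite lerBlDr ler_pdivrMr//.
  by move: e2 => /(ler_wpM2r (ltW p0)); rewrite yE; nra.
rewrite subr_ge0 ler_pdivlMr// -yE mulrC ler_wpM2r ?(ltW p0)//.
Qed.

(** Three errors are added: replacing [xi] by [ou_ar], the terms - eta_N^2 + M_N of the energy
    identity divided by N (1 - a^2), and the bias of the limiting variance. [Q] depends on delta but
    not on N. *)
Lemma ou_grid_lln C : (forall t, 0 <= t -> L2le P (xi t) C) ->
  exists2 Q, 0 <= Q & forall N, (0 < N)%N ->
  L1le P (fun w => N%:R^-1 * \sum_(j < N) xi (grid j) w ^+ 2 - (2 * theta)^-1)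
    (((1 + theta) * (3 * C + 1 + theta) + 1) * Num.sqrt delta + Q / Num.sqrt N%:R).
Proof.
move=> xC; have /andP[a0 a1] := decay_delta.
have C0 : 0 <= C by case: (xC 0 (lexx 0)).
set a := decay delta in a0 a1 *; set sd := Num.sqrt delta.
have b0 : 0 < 1 - a by rewrite subr_gt0.
have b2 : 0 < 1 - a ^+ 2 by rewrite subr_gt0 exprn_ilt1.
have sd1 : sd <= 1 by rewrite -[leRHS]sqrtr1 ler_wsqrtr.
have r0 : 0 <= r by rewrite divr_ge0 ?(ltW b0)// !mulr_ge0 ?(ltW sd0)// ltW.
have r1 := discretisation_error_le; rewrite -/sd in r1.
have rt : r <= 1 + theta.
  apply: le_trans r1 _; rewrite -[leRHS]mulr1; apply: ler_wpM2l => //.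
  by apply: addr_ge0 => //; exact: ltW.
(* Bounds the norm of [xi] plus that of [ou_ar]: C, then C again and an error of at most C + r, with
   r <= 1 + theta. *)
set D := 3 * C + 1 + theta.
have D0 : 0 <= D by rewrite /D; have := ltW theta0; lra.
have [c Lc] := L2le_sqr_normal_law P sd0.
have L2N j : L2le P (noise j) sd := L2le_normal_law sd0 (noise_normal j).
have L4N j : L2le P (fun w => noise j w ^+ 2) c := Lc _ (noise_normal j).
have [k k0 LM] : exists2 k, 0 <= k & forall N,
    L2le P (ar_martingale noise a sd N) (Num.sqrt N%:R * k).
  eexists; last first.
    by move=> N; apply: (L2le_ar_martingale noise_independent noise_mean noise_sqr L2N L4N a0 a1).
  have c0 : 0 <= c by case: (L4N 0%N).
  apply: addr_ge0; last by apply: addr_ge0 => //; exact: sqr_ge0.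
  apply: mulr_ge0; first exact: mulr_ge0.
  by apply: mulr_ge0; [apply: divr_ge0|]; exact: ltW.
set b := sd / (1 - a).
have LA j : L2le P (ou_ar j) b by exact: (L2le_ar L2N a0 a1).
pose Q := D * C / (1 - a) + (b ^+ 2 + k) / (1 - a ^+ 2).
exists Q.
  rewrite addr_ge0//; first by rewrite divr_ge0 ?(ltW b0)// mulr_ge0.
  by rewrite divr_ge0 ?(ltW b2)// addr_ge0// sqr_ge0.
move=> N N0.
have n0 : 0 < N%:R :> R by rewrite ltr0n.
pose q : R := Num.sqrt N%:R.
have q0 : 0 < q by rewrite sqrtr_gt0.
have q2 : N%:R = q ^+ 2 by rewrite sqr_sqrtr// ltW.
have q1 : 1 <= q by rewrite -[leLHS]sqrtr1 ler_wsqrtr// ler1n.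
have Ldiff j : L1le P (fun w => xi (grid j) w ^+ 2 - ou_ar j w ^+ 2) ((a ^+ j * C + r) * D).
  have LE := L2le_ou_ar j xC.
  have Lx := xC _ (grid_ge0 j).
  (* The norm of [ou_ar] is bounded through [xi], since [b] is of order delta^(-1/2) and would spoil
     the limit in delta. In [LAN] the bound [b] is harmless, being divided by N. *)
  have LA' := L2le_eq (fun w => subKr (xi (grid j) w) (ou_ar j w)) (L2leB Lx LE).
  apply: L1le_le (L2le_L1le_sqrB LE Lx LA').
  rewrite -/a -/r; apply: ler_wpM2l; first by rewrite addr_ge0// mulr_ge0// exprn_ge0.
  have : a ^+ j * C <= C by rewrite -[leRHS]mul1r ler_wpM2r// exprn_ile1// ltW.
  rewrite /D; lra.
have Lsum := L1le_sum (fun j (_ : (j < N)%N) => Ldiff j).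
have LAN : L1le P (fun w => - ou_ar N w * ou_ar N w) (b * b).
  exact: L2le_L1leM (L2leN (LA N)) (LA N).
have LMN := L2le_L1le (LM N).
have L2 := L1leD LAN LMN.
apply: L1le_le (L1le_eq _ (L1leD (L1leD (L1leZ N%:R^-1 Lsum)
  (L1leZ (N%:R * (1 - a ^+ 2))^-1 L2))
  (L1le_cst P (delta / (1 - a ^+ 2) - (2 * theta)^-1)))); last first.
  move=> w /=; rewrite sumrB.
  have := ar_energy noise a sd N w; rewrite -/(ou_ar N w).
  rewrite sqr_sqrtr ?(ltW delta0)//.
  have -> : \sum_(j < N) ar noise a j w ^+ 2 = \sum_(j < N) ou_ar j w ^+ 2 by [].
  set S := \sum_(j < N) ou_ar j w ^+ 2; set X := \sum_(j < N) _ ^+ 2.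
  set M := ar_martingale _ _ _ _ _.
  move=> E; have -> : M = (1 - a ^+ 2) * S - (N%:R * delta - ou_ar N w ^+ 2) by rewrite E; ring.
  by field; rewrite !gt_eqF// mulr_gt0.
have p0 : 0 < N%:R^-1 :> R by rewrite invr_gt0.
have p1 : 0 < (N%:R * (1 - a ^+ 2))^-1 by rewrite invr_gt0 mulr_gt0.
rewrite (gtr0_norm p0) (gtr0_norm p1).
apply: le_trans (lerD (lexx _) asymptotic_variance_le) _.
have S1 : \sum_(j < N) (a ^+ j * C + r) * D <= (C / (1 - a) + N%:R * r) * D.
  rewrite -mulr_suml big_split/= -mulr_suml ler_wpM2r// sumr_const card_ord.
  rewrite -[r *+ N]mulr_natl lerD2r.
  by rewrite mulrC ler_wpM2l// geometric_sum_le.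
have {}S1 := ler_wpM2l (ltW p0) S1.
apply: le_trans (lerD (lerD S1 (lexx _)) (lexx _)) _.
have dsd : delta <= sd.
  have : delta = sd ^+ 2 by rewrite sqr_sqrtr// ltW.
  have := ltW sd0; rewrite -/sd; nra.
have rD : r * D <= (1 + theta) * D * sd by rewrite [leRHS]mulrAC ler_wpM2r.
have pq : N%:R^-1 <= q^-1.
  by rewrite lef_pV2// q2 -[leLHS]mulr1 expr2 ler_pM2l.
have E1 : N%:R^-1 * ((C / (1 - a) + N%:R * r) * D) = D * C / (1 - a) * N%:R^-1 + r * D.
  by field; rewrite !gt_eqF.
have E2 : (N%:R * (1 - a ^+ 2))^-1 * (b * b + q * k) =
    b ^+ 2 / (1 - a ^+ 2) * N%:R^-1 + k / (1 - a ^+ 2) * q^-1.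
  by rewrite q2; field; rewrite !gt_eqF.
rewrite E1 E2.
have B1 : D * C / (1 - a) * N%:R^-1 <= D * C / (1 - a) * q^-1.
  by rewrite ler_wpM2l// divr_ge0 ?(ltW b0)// mulr_ge0.
have B2 : b ^+ 2 / (1 - a ^+ 2) * N%:R^-1 <= b ^+ 2 / (1 - a ^+ 2) * q^-1.
  by rewrite ler_wpM2l// divr_ge0 ?(ltW b2)// sqr_ge0.
have QE : Q / q = D * C / (1 - a) * q^-1 +
    (b ^+ 2 / (1 - a ^+ 2) * q^-1 + k / (1 - a ^+ 2) * q^-1).
  by rewrite /Q; field; rewrite !gt_eqF.
have SE : ((1 + theta) * D + 1) * sd = (1 + theta) * D * sd + sd by ring.
rewrite -/q QE SE; apply: le_trans (lerD (lerD (lerD B1 rD) (lerD B2 (lexx _))) dsd) _.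
by rewrite le_eqVlt; apply/orP; left; apply/eqP; ring.
Qed.

End discretisation.

End OU_bounds.

(** * Time averages of the squared process *)

Section caratheodory.
Context d (T : measurableType d) (R : realType).
Notation lam := (@lebesgue_measure R).

(** Rounding the time down to a multiple of 1 / (m + 1) gives a function whose preimages are
    countable unions of rectangles; by continuity of the paths these functions converge pointwise to
    f. *)
Lemma measurable_caratheodory (f : R -> T -> R) :
  (forall t, measurable_fun setT (f t)) ->
  (forall w, continuous (fun t => f t w : R)) ->
  measurable_fun setT (fun z : T * measurableTypeR R => f z.2 z.1).
Proof.
move=> mf cf.
pose g (m : nat) (z : T * measurableTypeR R) :=
  f ((Num.floor (m.+1%:R * z.2))%:~R / m.+1%:R) z.1.
apply: (@measurable_fun_cvg _ _ R setT g) => [m|[w t] _].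
  move=> _ B mB; rewrite setTI.
  have -> : g m @^-1` B = \bigcup_(k : int)
      ((f (k%:~R / m.+1%:R) @^-1` B) `*`
       [set` `[k%:~R / m.+1%:R, (k + 1)%:~R / m.+1%:R[ ]).
    apply/seteqP; split=> [[w t] /= Bg|[w t] [k _ [/= Bf]]].
      exists (Num.floor (m.+1%:R * t)) => //; split=> //=.
      have /andP[h1 h2] := floor_itv (m.+1%:R * t : R).
      by rewrite in_itv/= ler_pdivrMr// ltr_pdivlMr// (mulrC t) h1 h2.
    rewrite in_itv/= ler_pdivrMr// ltr_pdivlMr// => kt.
    by rewrite /g /= (@floor_def _ _ k)// mulrC.
  apply: countable_bigcupT_measurable => [|k]; first exact: countableP.
  apply: measurableX; last exact: measurable_itv.
  by rewrite -[X in measurable X]setTI; exact: mf.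
suff H : (fun m : nat => (Num.floor (m.+1%:R * t))%:~R / m.+1%:R) @ \oo --> (t : R).
  exact: (cvg_comp _ _ H (cf w t)).
apply/cvgrPdist_le => e e0; near=> m.
have m0 : 0 < m.+1%:R :> R by [].
have /andP[h1 h2] := floor_itv (m.+1%:R * t : R).
have -> : t - (Num.floor (m.+1%:R * t))%:~R / m.+1%:R =
    (m.+1%:R * t - (Num.floor (m.+1%:R * t))%:~R) / m.+1%:R.
  by field; rewrite gt_eqF.
rewrite ger0_norm ?divr_ge0 ?subr_ge0// ler_pdivrMr//.
apply: (@le_trans _ _ 1); first by move: h2; rewrite intrD; lra.
rewrite mulrC -ler_pdivrMr// div1r.
apply: le_trans (_ : m%:R <= _); last by rewrite ler_nat.
by near: m; exact: nbhs_infty_ger.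
Unshelve. all: by end_near. Qed.

Lemma measurable_integral_param (v : T * measurableTypeR R -> R) (D : set (measurableTypeR R)) :
  measurable_fun setT v -> measurable D -> (forall z, 0 <= v z) ->
  measurable_fun setT (fun w => \int[lam]_(t in D) (v (w, t))%:E)%E.
Proof.
move=> mv mD v0.
have mh : measurable_fun setT (fun z : T * measurableTypeR R => (v z * \1_D z.2)%:E).
  apply/measurable_EFinP; apply: measurable_funM => //.
  exact: (measurableT_comp (@measurable_indic _ _ R setT D mD) measurable_snd).
have h0 z : (0 <= (v z * \1_D z.2)%:E)%E by rewrite lee_fin mulr_ge0.
have := measurable_fun_fubini_tonelli_F (m2 := lam) _ mh h0.
apply: eq_measurable_fun => w _; rewrite /fubini_F [RHS]integral_mkcond.
apply: eq_integral => t _; rewrite patchE /= indicE.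
by case: ifP => _; rewrite ?mulr1// mulr0.
Qed.

Lemma measurable_Rintegral_param (v : T * measurableTypeR R -> R) (D : set (measurableTypeR R)) :
  measurable_fun setT v -> measurable D -> (forall z, 0 <= v z) ->
  measurable_fun setT (fun w => \int[lam]_(t in D) v (w, t)).
Proof.
by move=> mv mD v0; apply: measurableT_comp => //; exact: measurable_integral_param.
Qed.

(** By Tonelli, a bound on the mean at each time gives one on the mean of the time integral. *)
Lemma integral_param_le (P : probability T R) (v : T * measurableTypeR R -> R)
    (D : set (measurableTypeR R)) (K : R) :
  measurable_fun setT v -> measurable D -> (forall z, 0 <= v z) ->
  (forall t, D t -> (\int[P]_w (v (w, t))%:E <= K%:E)%E) ->
  (\int[P]_w \int[lam]_(t in D) (v (w, t))%:E <= K%:E * lam D)%E.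
Proof.
move=> mv mD v0 vK.
have mh : measurable_fun setT (fun z : T * measurableTypeR R => (v z * \1_D z.2)%:E).
  apply/measurable_EFinP; apply: measurable_funM => //.
  exact: (measurableT_comp (@measurable_indic _ _ R setT D mD) measurable_snd).
have h0 z : (0 <= (v z * \1_D z.2)%:E)%E by rewrite lee_fin mulr_ge0.
have mG := measurable_fun_fubini_tonelli_G (m1 := P) _ mh h0.
have -> : (\int[P]_w \int[lam]_(t in D) (v (w, t))%:E =
    \int[P]_w \int[lam]_t (v (w, t) * \1_D t)%:E)%E.
  apply: eq_integral => w _; rewrite integral_mkcond.
  apply: eq_integral => t _; rewrite patchE /= indicE.
  by case: ifP => _; rewrite ?mulr1// mulr0.
rewrite (fubini_tonelli (m1 := P) (m2 := lam) _ mh h0).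
have -> : (K%:E * lam D = \int[lam]_t (K%:E * (\1_D t)%:E))%E.
  under eq_integral do rewrite muleC.
  rewrite -integral_cst// [LHS]integral_mkcond; apply: eq_integral => t _.
  by rewrite patchE /= indicE; case: ifP => _; rewrite ?mul1e ?mul0e.
apply: ge0_le_integral => //.
- by move=> t _; apply: integral_ge0 => w _; exact: h0.
- by apply: emeasurable_funM => //; apply/measurable_EFinP; exact: measurable_indic.
- move=> t _ /=; rewrite indicE; case: (boolP (t \in D)) => [/set_mem Dt|_].
    by rewrite mule1; under eq_integral do rewrite mulr1; exact: vK.
  by rewrite mule0; under eq_integral do rewrite mulr0; rewrite integral0.
Qed.

End caratheodory.

Section time_average.
Context (R : realType) d (Omega : measurableType d) (P : probability Omega R).
Variables (xi : R -> {RV P >-> R}).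
Hypothesis cxi : forall w, continuous (fun t => xi t w : R).
Notation lam := (@lebesgue_measure R).

Lemma measurable_paths : measurable_fun setT (fun z : Omega * measurableTypeR R => xi z.2 z.1).
Proof.
by apply: (@measurable_caratheodory _ _ _ (fun t w => xi t w)) => // t; exact: measurable_funPT.
Qed.

Lemma continuous_sqr_path w : continuous (fun t => xi t w ^+ 2 : R).
Proof.
move=> t; apply: (@continuous_comp _ _ _ (fun t => xi t w : R) (fun x => x ^+ 2)).
  exact: cxi.
exact: exprn_continuous.
Qed.

Lemma integrable_itv (f : R -> R) (a b : R) : continuous f ->
  lam.-integrable `[a, b] (EFin \o f).
Proof.
move=> cf; apply: continuous_compact_integrable; first exact: segment_compact.
exact: continuous_subspaceT.
Qed.

Lemma measurable_energy (a b : R) :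
  measurable_fun setT (fun w => \int[lam]_(t in `[a, b]) (xi t w ^+ 2)).
Proof.
apply: (@measurable_Rintegral_param _ _ _ (fun z => xi z.2 z.1 ^+ 2)).
- by apply: measurable_funX; exact: measurable_paths.
- exact: measurable_itv.
- by move=> z; exact: sqr_ge0.
Qed.

Lemma L1le_energy_interval (s delta K : R) : 0 <= delta ->
  (forall t, s <= t <= s + delta -> L1le P (fun w => xi t w ^+ 2 - xi s w ^+ 2) K) ->
  L1le P (fun w => \int[lam]_(t in `[s, s + delta]) (xi t w ^+ 2) - delta * xi s w ^+ 2)
    (delta * K).
Proof.
move=> delta0 H; split.
  apply: measurable_funB; first exact: measurable_energy.
  by apply: measurable_funM => //; exact: measurable_funX.
set D := `[s, s + delta]%classic.
have lamD : lam D = delta%:E.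
  rewrite /D [LHS](@lebesgue_measure_itv R `[s, s + delta])/= lte_fin ltrDl.
  case: ltP => [_|d0]; first by rewrite -EFinB addrC addKr.
  by congr EFin; apply/eqP; rewrite eq_le delta0 d0.
pose v (z : Omega * measurableTypeR R) := `|xi z.2 z.1 ^+ 2 - xi s z.1 ^+ 2|.
have mv : measurable_fun setT v.
  apply: measurableT_comp => //; apply: measurable_funB.
    by apply: measurable_funX; exact: measurable_paths.
  by apply: measurable_funX; apply: measurableT_comp => //; exact: measurable_fst.
have cv w : continuous (fun t => xi t w ^+ 2 - xi s w ^+ 2 : R).
  by move=> t; apply: cvgB; [exact: continuous_sqr_path|exact: cvg_cst].
have := @integral_param_le _ _ _ P v D K mv (measurable_itv _) (fun=> normr_ge0 _).
rewrite lamD muleC => L; apply: le_trans (L _); last first.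
  by move=> t; rewrite /D /= in_itv/= => /H[].
apply: ge0_le_integral => //.
- apply/measurable_EFinP; apply: measurableT_comp => //.
  apply: measurable_funB; first exact: measurable_energy.
  by apply: measurable_funM => //; exact: measurable_funX.
- exact: (@measurable_integral_param _ _ _ v D mv (measurable_itv _) (fun=> normr_ge0 _)).
- move=> w _.
  have iv : lam.-integrable D (EFin \o (fun t => xi t w ^+ 2 - xi s w ^+ 2)).
    exact: integrable_itv.
  have RC : \int[lam]_(t in D) (xi s w ^+ 2) = xi s w ^+ 2 * fine (lam D).
    by apply: Rintegral_cst; exact: measurable_itv.
  have -> : \int[lam]_(t in D) (xi t w ^+ 2) - delta * xi s w ^+ 2 =
      \int[lam]_(t in D) (xi t w ^+ 2 - xi s w ^+ 2).
    rewrite RintegralB//.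
    + by rewrite RC lamD mulrC.
    + exact: measurable_itv.
    + by apply: integrable_itv; exact: continuous_sqr_path.
    + by apply: integrable_itv => t; exact: cvg_cst.
  apply: le_trans (_ : (\int[lam]_(t in D) `|xi t w ^+ 2 - xi s w ^+ 2|)%:E <= _)%E.
    by rewrite lee_fin; apply: le_normr_Rintegral => //; exact: measurable_itv.
  rewrite /Rintegral fineK//.
  apply: integrable_fin_num; first exact: measurable_itv.
  exact: (integrable_norm iv).
Qed.

Lemma energy_grid (delta : R) (w : Omega) (N : nat) : 0 <= delta ->
  \int[lam]_(t in `[0, grid delta N]) (xi t w ^+ 2) =
  \sum_(j < N) \int[lam]_(t in `[grid delta j, grid delta j + delta]) (xi t w ^+ 2).
Proof.
move=> delta0; have ci a b := @integrable_itv _ a b (@continuous_sqr_path w).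
have gS j : grid delta j.+1 = grid delta j + delta by rewrite /grid -natr1 mulrDl mul1r.
elim: N => [|N IH].
  by rewrite big_ord0 /grid mul0r set_itv1 Rintegral_set1.
rewrite big_ord_recr/= -IH gS.
have g0 : 0 <= grid delta N by rewrite mulr_ge0.
have := @Rintegral_itvB R (fun t => xi t w ^+ 2) (BLeft 0) (BRight (grid delta N + delta))
  (grid delta N) (ci _ _).
rewrite !bnd_simp lerDl => /(_ g0 delta0) /eqP; rewrite subr_eq addrC => /eqP ->.
congr (_ + _); rewrite Rintegral_itv_obnd_cbnd//.
apply: integrableS (ci (grid delta N) (grid delta N + delta)) => //.
exact: subset_itv_oc_cc.
Qed.

Lemma L1le_energy_grid (delta K : R) (N : nat) : 0 < delta -> (0 < N)%N ->
  (forall s t, 0 <= s -> s <= t <= s + delta ->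
     L1le P (fun w => xi t w ^+ 2 - xi s w ^+ 2) K) ->
  L1le P (fun w => (grid delta N)^-1 * \int[lam]_(t in `[0, grid delta N]) (xi t w ^+ 2) -
    N%:R^-1 * \sum_(j < N) xi (grid delta j) w ^+ 2) K.
Proof.
move=> delta0 N0 H.
have n0 : 0 < N%:R :> R by rewrite ltr0n.
have g0 : 0 < grid delta N by rewrite mulr_gt0.
have step j : L1le P (fun w => \int[lam]_(t in `[grid delta j, grid delta j + delta]) (xi t w ^+ 2)
    - delta * xi (grid delta j) w ^+ 2) (delta * K).
  apply: L1le_energy_interval; first exact: ltW.
  by move=> t; apply: H; rewrite mulr_ge0// ltW.
apply: L1le_le (L1le_eq _ (L1leZ (grid delta N)^-1 (L1le_sum (fun j (_ : (j < N)%N) => step j)))).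
  rewrite gtr0_norm ?invr_gt0// sumr_const card_ord -[_ *+ N]mulr_natl.
  by rewrite /grid le_eqVlt; apply/orP; left; apply/eqP; field; rewrite !gt_eqF.
move=> w /=; rewrite sumrB -(energy_grid w N (ltW delta0)) -mulr_sumr mulrBr.
by congr (_ - _); rewrite /grid; field; rewrite !gt_eqF.
Qed.

End time_average.

(** * Convergence of the averaged energy in L^1 *)

Section OU_energy.
Context (R : realType) d (Omega : measurableType d) (P : probability Omega R).
Variables (W xi : R -> {RV P >-> R}) (theta h : R).
Hypothesis hW : two_sided_wiener W.
Hypothesis theta0 : 0 < theta.
Hypothesis h0 : 0 < h.
Hypothesis hxi : ornstein_uhlenbeck theta W xi.
Notation lam := (@lebesgue_measure R).

Lemma ou_energy_lln (e : R) : 0 < e -> \forall n \near \oo,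
  L1le P (fun w => (n%:R * h)^-1 * \int[lam]_(t in `[0, n%:R * h]) (xi t w ^+ 2) -
    (2 * theta)^-1) e.
Proof.
move=> e0; have [C xC] := ou_bounded hW theta0 hxi.
have C0 : 0 <= C by case: (xC 0 (lexx 0)).
pose K := (theta * C + 1 + theta) * (2 * C) + ((1 + theta) * (3 * C + 1 + theta) + 1).
have K0 : 0 < K.
  have t0 := ltW theta0.
  have p1 : 0 <= (theta * C + 1 + theta) * (2 * C).
    by apply: mulr_ge0; [rewrite !addr_ge0// mulr_ge0|rewrite mulr_ge0].
  have p2 : 0 <= (1 + theta) * (3 * C + 1 + theta).
    by apply: mulr_ge0; rewrite !addr_ge0// mulr_ge0.
  rewrite /K; lra.
(* [K] collects all the coefficients of sqrt delta; a mesh below [q] makes their contribution at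
   most e / 2. *)
pose q := Num.min 1 ((e / 2 / K) ^+ 2).
have q0 : 0 < q by rewrite lt_min ltr01 exprn_gt0// !divr_gt0.
pose m := Num.truncn (h / q).
(* The mesh divides [h], so that every observation time n h is a grid point. *)
pose delta := h / m.+1%:R.
have delta0 : 0 < delta by rewrite divr_gt0.
have dq : delta <= q.
  rewrite ler_pdivrMr// mulrC -ler_pdivrMr// ltW//.
  by have /andP[_] := truncn_itv (ltW (divr_gt0 h0 q0)).
have delta1 : delta <= 1 by apply: le_trans dq _; rewrite ge_min lexx.
have sdK : K * Num.sqrt delta <= e / 2.
  have e2 : 0 <= e / 2 / K by rewrite !divr_ge0// ltW.
  rewrite mulrC -ler_pdivlMr// -(ger0_norm e2) -sqrtr_sqr ler_wsqrtr//.
  by apply: le_trans dq _; rewrite ge_min lexx orbT.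
have [Q Q0 LQ] := ou_grid_lln hW theta0 hxi delta0 delta1 xC.
near=> n.
have n0 : (0 < n)%N by near: n; exact: nbhs_infty_gt.
pose N := (n * m.+1)%N.
have N0 : (0 < N)%N by rewrite muln_gt0 n0.
have gN : grid delta N = n%:R * h.
  by rewrite /grid /N /delta natrM -mulrA (mulrC m.+1%:R) divfK.
have L1 := LQ N N0.
have L2 : L1le P (fun w => (grid delta N)^-1 * \int[lam]_(t in `[0, grid delta N]) (xi t w ^+ 2) -
    N%:R^-1 * \sum_(j < N) xi (grid delta j) w ^+ 2)
    ((theta * C + 1 + theta) * Num.sqrt delta * (2 * C)).
  apply: L1le_energy_grid => //; first exact: ou_continuous_paths hxi.
  move=> s t s0 /andP[st ts].
  have t0 : 0 <= t by exact: le_trans st.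
  have Lst : L2le P (fun w => xi t w - xi s w) ((theta * C + 1 + theta) * Num.sqrt delta).
    have tsd : 0 <= t - s <= 1 by apply/andP; split; lra.
    apply: L2le_le (ou_increment hW theta0 hxi (xC s s0) tsd).
    apply: ler_wpM2l; last by apply: ler_wsqrtr; lra.
    by rewrite !addr_ge0// ?mulr_ge0// ltW.
  apply: L1le_le (L2le_L1le_sqrB Lst (xC t t0) (xC s s0)).
  by rewrite -mulr2n -[C *+ 2]mulr_natl.
rewrite -gN; apply: L1le_le (L1le_eq _ (L1leD L2 L1)); last by move=> w /=; ring.
have QN : Q / Num.sqrt N%:R <= e / 2.
  have sN : 0 < Num.sqrt (N%:R : R) by rewrite sqrtr_gt0 ltr0n.
  rewrite ler_pdivrMr// mulrC -ler_pdivrMr ?divr_gt0//.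
  have q1 : 0 <= Q / (e / 2) by rewrite !divr_ge0// ltW.
  rewrite -(ger0_norm q1) -sqrtr_sqr ler_wsqrtr//.
  apply: le_trans (_ : n%:R <= _); last by rewrite ler_nat leq_pmulr.
  by near: n; exact: nbhs_infty_ger.
move: sdK QN; rewrite /K mulrDl; lra.
Unshelve. all: by end_near. Qed.

End OU_energy.

(** * Consistency of the plug-in predictor *)

Section estimator.
Context (R : realType).

(** Writing 1 / x as x (x^2)^(-1) reduces the claim to real powers of nonnegative numbers; at 0 the
    factor x restores the convention 1 / 0 = 0. *)
Lemma measurable_invr : measurable_fun setT (fun x : R => x^-1).
Proof.
rewrite (_ : (fun x => _) = fun x => x * (x ^+ 2) `^ (- 1)); last first.
  apply/funext => x; rewrite powR_inv1 ?sqr_ge0//.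
  have [->|x0] := eqVneq x 0; first by rewrite invr0 mul0r.
  by field.
apply: measurable_funM => //.
by apply: (measurableT_comp (measurable_powR _)); exact: measurable_funX.
Qed.

Lemma expR_lipschitz_le0 (x y : R) : x <= 0 -> y <= 0 ->
  `|expR x - expR y| <= `|x - y|.
Proof.
wlog xy : x y / x <= y.
  move=> H x0 y0; have [xy|/ltW yx] := leP x y; first exact: H.
  by rewrite distrC (distrC x); exact: H.
move=> x0 y0; rewrite !ler0_norm ?subr_le0 ?ler_expR// !opprB.
have -> : expR y - expR x = expR y * (1 - expR (x - y)).
  by rewrite mulrBr mulr1 -expRD; congr (_ - expR _); ring.
have : 1 - expR (x - y) <= y - x by have := expR_ge1Dx (x - y); lra.
have : 0 <= 1 - expR (x - y) by rewrite subr_ge0 -expR0 ler_expR subr_le0.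
have : expR y <= 1 by rewrite -expR0 ler_expR.
have := expR_ge0 y; nra.
Qed.

Context d (Omega : measurableType d) (P : probability Omega R).

Lemma L1le_probability (f : Omega -> R) (c K : R) : L1le P f c -> 0 < K ->
  (P [set w | (K <= `|f w|)%R] <= (c / K)%:E)%E.
Proof.
move=> [mf fc] K0.
have := @markov _ _ _ P (mfun_Sub (mem_set mf)) id K K0 (@measurable_id _ _ _)
  (fun _ h => h) (fun _ _ _ _ h => h).
rewrite unlock /= => /le_trans /(_ fc).
have -> : [set x | (K%:E <= `|f x|%:E)%E] = [set w | (K <= `|f w|)%R].
  by apply/seteqP; split => w /=; rewrite lee_fin.
by rewrite EFinM lee_pdivlMr// muleC.
Qed.

Lemma cvge0P (u : nat -> \bar R) : (forall n, (0 <= u n)%E) ->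
  (forall e : R, 0 < e -> \forall n \near \oo, (u n <= e%:E)%E) ->
  u @ \oo --> 0%E.
Proof.
move=> u0 H; apply/fine_cvgP; split.
  apply: filterS (H 1 ltr01) => n un.
  by rewrite ge0_fin_numE// (le_lt_trans un)// ltry.
apply/cvgr0Pnorm_le => e e0; apply: filterS (H e e0) => n un /=.
have nf : u n \is a fin_num by rewrite ge0_fin_numE// (le_lt_trans un)// ltry.
by rewrite ger0_norm ?fine_ge0// -lee_fin fineK.
Qed.

Variable xi : R -> {RV P >-> R}.
Hypothesis cxi : forall w, continuous (fun t => xi t w : R).

Lemma measurable_ou_mle (T : R) : measurable_fun setT (ou_mle xi T).
Proof.
apply: measurable_funM.
  apply: measurable_funB; first (apply: measurable_funD => //);
  by apply: measurable_funM => //; exact: measurable_funX.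
apply: (measurableT_comp measurable_invr).
by apply: measurable_funM => //; exact: measurable_energy.
Qed.

End estimator.

(** The difference is (2 theta (A - 1 / (2 theta)) - q) / (2 A), and k <= 1 / (4 theta) keeps A
    above 1 / (4 theta), so that 1 / (2 A) <= 2 theta. *)
Lemma mle_perturbation (R : realFieldType) (theta A q k : R) :
  0 < theta -> k <= (4 * theta)^-1 -> `|A - (2 * theta)^-1| <= k -> `|q| <= k ->
  `|theta - (1 + q) / (2 * A)| <= k * ((1 + 2 * theta) * (2 * theta)).
Proof.
move=> theta0 k1 Ak qk; have k0 : 0 <= k by exact: le_trans qk.
have r4 : (2 * theta)^-1 = 2 * (4 * theta)^-1 by field; rewrite gt_eqF.
have r40 : 0 < (4 * theta)^-1 by rewrite invr_gt0 mulr_gt0.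
have A0 : (4 * theta)^-1 <= A.
  by move: Ak; rewrite ler_norml => /andP[]; lra.
have A3 : 0 < A by exact: lt_le_trans A0.
have -> : theta - (1 + q) / (2 * A) =
    (2 * theta * (A - (2 * theta)^-1) - q) / (2 * A).
  by field; rewrite !gt_eqF.
rewrite normrM (gtr0_norm (x := (2 * A)^-1)) ?invr_gt0 ?mulr_gt0//.
rewrite ler_pdivrMr ?mulr_gt0//.
apply: le_trans (_ : (2 * theta + 1) * k <= _).
  apply: le_trans (ler_normB _ _) _.
  rewrite normrM (gtr0_norm (x := 2 * theta)) ?mulr_gt0//.
  by rewrite [leRHS]mulrDl mul1r lerD// ler_pM2l ?mulr_gt0.
set B := k * _; have B0 : 0 <= B.
  by rewrite /B !mulr_ge0// ?addr_ge0// ?mulr_ge0// ltW.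
apply: le_trans (_ : B * (2 * (4 * theta)^-1) <= _); last first.
  by rewrite ler_wpM2l// ler_pM2l.
rewrite -r4 ler_pdivlMr ?mulr_gt0// /B.
by rewrite le_eqVlt; apply/orP; left; apply/eqP; ring.
Qed.

(** * Error of the predictor for a given value of the estimate *)

Section plugin_error.
Context (R : realType) (h : R).
Hypothesis h0 : 0 < h.
Notation lam := (@lebesgue_measure R).

Lemma rhoB (u v t : R) (X : R -> R) :
  (rho h u X \- rho h v X) t = (expR (- (u * t)) - expR (- (v * t))) * X h.
Proof. by rewrite /rho /= mulrBl. Qed.

Lemma measurable_rho (u : R) (X : R -> R) : measurable_fun setT (rho h u X).
Proof.
apply: measurable_funM => //; apply: measurableT_comp => //.
by apply: measurableT_comp => //; exact: measurable_funM.
Qed.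

Lemma Hnorm_gtE (f : R -> R) (e : R) : measurable_fun setT f -> 0 <= e ->
  (e%:E < Hnorm h f)%E =
  ((e ^+ 2)%:E < \int[lam]_(t in `[0%R, h]) (f t ^+ 2)%:E + (f h ^+ 2)%:E)%E.
Proof.
move=> mf e0; rewrite -Hnorm_sqr// Lnorm2_sqr !ltNge; congr (~~ _).
by apply/idP/idP => /(Lnorm2_le _ _ e0).
Qed.

(** The exponents are nonpositive, where exp is 1-Lipschitz, hence a pointwise bound; h + 1 is the
    total mass of Lebesgue measure on [0, h] plus the Dirac mass. *)
Lemma plugin_error_le (u v x a : R) : 0 <= u -> 0 <= v -> `|u - v| <= a ->
  (\int[lam]_(t in `[0%R, h]) (((expR (- (u * t)) - expR (- (v * t))) * x) ^+ 2)%:E +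
   (((expR (- (u * h)) - expR (- (v * h))) * x) ^+ 2)%:E <=
   ((h * a * `|x|) ^+ 2 * (h + 1))%:E)%E.
Proof.
move=> u0 v0 uva.
have a0 : 0 <= a by exact: le_trans uva.
have key t : 0 <= t <= h ->
    ((expR (- (u * t)) - expR (- (v * t))) * x) ^+ 2 <= (h * a * `|x|) ^+ 2.
  move=> /andP[t0 th]; rewrite -[leLHS]real_normK ?num_real// ler_sqr ?nnegrE//; last first.
    by rewrite !mulr_ge0// ltW.
  rewrite normrM ler_wpM2r//.
  apply: le_trans (expR_lipschitz_le0 _ _) _.
  - by rewrite oppr_le0 mulr_ge0.
  - by rewrite oppr_le0 mulr_ge0.
  - rewrite (_ : _ - _ = - t * (u - v)); last by ring.
    by rewrite normrM normrN (ger0_norm t0) ler_pM.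
have lamh : lam `[0, h]%classic = h%:E.
  by rewrite [LHS](@lebesgue_measure_itv R `[0, h])/= lte_fin h0 oppr0 adde0.
rewrite mulrDr mulr1 EFinD leeD//; last first.
  by rewrite lee_fin; apply: key; rewrite lexx ltW.
apply: le_trans (_ : \int[lam]_(t in `[0%R, h]) (cst ((h * a * `|x|) ^+ 2)%:E t) <= _)%E.
  have mf : measurable_fun setT (fun t : R =>
      (((expR (- (u * t)) - expR (- (v * t))) * x) ^+ 2)%:E).
    apply/measurable_EFinP/measurable_funX/measurable_funM => //.
    by apply: measurable_funB; apply: measurableT_comp => //;
      apply: measurableT_comp => //; exact: measurable_funM.
  apply: ge0_le_integral; first exact: measurable_itv.
  - by move=> t _; rewrite lee_fin sqr_ge0.
  - exact: measurable_funTS.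
  - exact: measurable_cst.
  - by move=> t; rewrite /= in_itv/= => /key; rewrite lee_fin.
have RC : (\int[lam]_(t in `[0%R, h]) (cst ((h * a * `|x|) ^+ 2)%:E t) =
    ((h * a * `|x|) ^+ 2)%:E * lam `[0%R, h]%classic)%E.
  by apply: integral_cst; exact: measurable_itv.
by rewrite RC lamh EFinM.
Qed.

End plugin_error.

Theorem corollary1 (R : realType) (d : measure_display)
    (Omega : measurableType d) (P : probability Omega R)
    (theta h : R) (W xi : R -> {RV P >-> R}) :
  0 < theta -> 0 < h ->
  two_sided_wiener W -> ornstein_uhlenbeck theta W xi ->
  cvg_in_probability P
    (fun n w =>
       let X := segment xi h (n%:Z - 1) w in
       let theta_n := ou_mle xi (n%:R * h) w in
       Hnorm h (rho h theta X \- rho h theta_n X))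
    (cst 0%E).
Proof.
move=> theta0 h0 hW hxi eps eps0 /=.
have cxi := ou_continuous_paths hxi.
have [C xC] := ou_bounded hW theta0 hxi.
have C0 : 0 <= C by case: (xC 0 (lexx 0)).
pose u n w := ou_mle xi (n%:R * h) w.
pose x (n : nat) w := xi (n%:R * h) w.
pose v (n : nat) (z : Omega * measurableTypeR R) :=
  ((expR (- (theta * z.2)) - expR (- (u n z.1 * z.2))) * x n z.1) ^+ 2.
pose err (n : nat) w := (\int[@lebesgue_measure R]_(t in `[0%R, h]) (v n (w, t))%:E +
  (v n (w, h))%:E)%E.
have mu n : measurable_fun setT (u n) by exact: measurable_ou_mle.
have mv n : measurable_fun setT (v n).
  apply: measurable_funX; apply: measurable_funM; last first.
    by apply: measurableT_comp => //; exact: measurable_fst.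
  apply: measurable_funB; apply: measurableT_comp => //; apply: measurableT_comp => //.
    by apply: measurable_funM => //; exact: measurable_snd.
  apply: measurable_funM; last exact: measurable_snd.
  by apply: measurableT_comp => //; exact: measurable_fst.
have mvh n : measurable_fun setT (fun w => v n (w, h)).
  exact: (@measurable_fun_pair1 _ _ _ _ _ _ (v n) h (mv n)).
have merr n : measurable_fun setT (err n).
  apply: emeasurable_funD; last exact/measurable_EFinP.
  exact: (@measurable_integral_param _ _ _ (v n) _ (mv n) (measurable_itv _) (fun=> sqr_ge0 _)).
(* The measure of an event is only controlled when the event is measurable, hence
   this explicit description of the error. *)
have setE n : [set w | (eps%:E < `|Hnorm h (rho h theta (segment xi h (n%:Z - 1) w) \-
      rho h (ou_mle xi (n%:R * h) w) (segment xi h (n%:Z - 1) w))%R - 0|)%E] =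
    [set w | ((eps ^+ 2)%:E < err n w)%E].
  apply/funext => w; apply/propext => /=.
  rewrite sube0 gee0_abs ?Lnorm_ge0// Hnorm_gtE ?ltW//; last first.
    by apply: measurable_funB; exact: measurable_rho.
  (* The last value of the segment n - 1 is taken at time (n - 1) h + h = n h, the end of the
     observation interval. *)
  have X1 : segment xi h (n%:Z - 1) w h = x n w.
    by rewrite /segment /x; congr (xi _ w); rewrite intrB -pmulrn; ring.
  have E t : (rho h theta (segment xi h (n%:Z - 1) w) \-
      rho h (ou_mle xi (n%:R * h) w) (segment xi h (n%:Z - 1) w)) t ^+ 2 = v n (w, t).
    by rewrite rhoB X1.
  by rewrite E; under eq_integral do rewrite E.
under eq_fun do rewrite setE.
apply: cvge0P => // e e0.
(* By Markov, [xi 0] and [x n] exceed K with probability at most C / K <= e / 3 each. *)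
pose K := 3 * (C + 1) / e.
have K0 : 0 < K by rewrite divr_gt0// mulr_gt0// ltr_wpDl.
(* Chosen so that h b K = eps / (h + 1); the squared error is then at most eps^2 / (h + 1). *)
pose b := eps / (h * K * (h + 1)).
have b0 : 0 < b.
  apply: divr_gt0 => //; apply: mulr_gt0; first exact: mulr_gt0.
  exact: addr_gt0.
(* An estimate within theta of theta is nonnegative, as [plugin_error_le] requires. *)
pose a := Num.min theta b.
have a0 : 0 < a by rewrite lt_min theta0.
pose k := Num.min (4 * theta)^-1 (a / ((1 + 2 * theta) * (2 * theta))).
have t2 : 0 < (1 + 2 * theta) * (2 * theta) by rewrite !mulr_gt0// addr_gt0// mulr_gt0.
have k0 : 0 < k by rewrite lt_min invr_gt0 mulr_gt0//= divr_gt0.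
have e3 : 0 < e / 3 by rewrite divr_gt0.
have := ou_energy_lln hW theta0 h0 hxi (mulr_gt0 e3 k0).
pose A (n : nat) w := (n%:R * h)^-1 * \int[@lebesgue_measure R]_(t in `[0, n%:R * h]) (xi t w ^+ 2).
move=> Hn; near=> n.
have LA : L1le P (fun w => A n w - (2 * theta)^-1) (e / 3 * k) by near: n; exact: Hn.
have n0 : (0 < n)%N by near: n; exact: nbhs_infty_gt.
have T0 : 0 < n%:R * h by rewrite mulr_gt0// ltr0n.
(* Makes both boundary terms of the estimator at most k when |xi_0| and |xi_T| are below K. *)
have KT : K ^+ 2 <= k * (n%:R * h).
  rewrite -ler_pdivrMl// -ler_pdivrMr//.
  by near: n; exact: nbhs_infty_ger.
pose B1 := [set w | (K <= `|xi 0 w|)%R].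
pose B2 := [set w | (K <= `|x n w|)%R].
pose B3 := [set w | (k <= `|A n w - (2 * theta)^-1|)%R].
have mset (f : Omega -> R) (c : R) : measurable_fun setT f -> measurable [set w | (c <= `|f w|)%R].
  move=> mf; rewrite -[X in measurable X]setTI.
  apply: (emeasurable_fun_c_infty (f := fun w => (`|f w|)%:E) _ _ c%:E) => //.
  by apply/measurable_EFinP; exact: measurableT_comp.
have mB1 : measurable B1 by exact: mset.
have mB2 : measurable B2 by exact: mset.
have mB3 : measurable B3 by apply: mset; case: LA.
have PB1 : (P B1 <= (e / 3)%:E)%E.
  apply: le_trans (L1le_probability (L2le_L1le (xC 0 (lexx 0))) K0) _.
  rewrite lee_fin ler_pdivrMr// /K (_ : e / 3 * _ = C + 1) ?lerDl//.
  by field; rewrite gt_eqF.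
have PB2 : (P B2 <= (e / 3)%:E)%E.
  apply: le_trans (L1le_probability (L2le_L1le (xC _ (ltW T0))) K0) _.
  rewrite lee_fin ler_pdivrMr// /K (_ : e / 3 * _ = C + 1) ?lerDl//.
  by field; rewrite gt_eqF.
have PB3 : (P B3 <= (e / 3)%:E)%E.
  apply: le_trans (L1le_probability LA k0) _.
  by rewrite mulfK// gt_eqF.
have sub : [set w | ((eps ^+ 2)%:E < err n w)%E] `<=` B1 `|` B2 `|` B3.
  move=> w /=; apply: contraPP => /not_orP[/not_orP[/negP b1 /negP b2] /negP b3].
  move: b1 b2 b3; rewrite -!ltNge => b1 b2 b3.
  apply/negP; rewrite -leNgt.
  suff uv : `|theta - u n w| <= a.
    have u0 : 0 <= u n w.
      have : a <= theta by rewrite ge_min lexx.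
      by move: uv; rewrite ler_norml => /andP[uv1 uv2]; lra.
    apply: le_trans (plugin_error_le h0 (x n w) (ltW theta0) u0 uv) _.
    rewrite lee_fin.
    have hab : h * a * `|x n w| <= eps / (h + 1).
      have -> : eps / (h + 1) = h * b * K by rewrite /b; field; rewrite !gt_eqF// addr_gt0.
      apply: ler_pM; rewrite ?mulr_ge0 ?(ltW h0) ?(ltW a0)//; last exact: ltW.
      by rewrite ler_pM2l// ge_min lexx orbT.
    have h1 : 1 <= h + 1 by rewrite lerDr ltW.
    have p0 : 0 <= h * a * `|x n w| by rewrite !mulr_ge0 ?(ltW h0) ?(ltW a0).
    apply: le_trans (_ : (eps / (h + 1)) ^+ 2 * (h + 1) <= _).
      rewrite ler_wpM2r ?(le_trans _ h1)// lerXn2r// nnegrE//.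
      by rewrite divr_ge0 ?(ltW eps0)// (le_trans _ h1).
    have -> : (eps / (h + 1)) ^+ 2 * (h + 1) = eps ^+ 2 / (h + 1).
      by field; rewrite gt_eqF// (lt_le_trans _ h1).
    by rewrite ler_pdivrMr ?(lt_le_trans _ h1)// ler_peMr// sqr_ge0.
  set T := n%:R * h in T0 KT *.
  have sqr_le y : `|y| < K -> 0 <= y ^+ 2 / T <= k.
    move=> yK; rewrite divr_ge0 ?sqr_ge0 ?(ltW T0)//= ler_pdivrMr//.
    apply: le_trans KT; rewrite -real_normK ?num_real// lerXn2r// ?nnegrE ?(ltW K0)//.
    exact: ltW.
  have /andP[p1 p2] := sqr_le _ b1; have /andP[p3 p4] := sqr_le _ b2.
  have uE : u n w = (1 + xi 0 w ^+ 2 / T - x n w ^+ 2 / T) / (2 * A n w).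
    by rewrite /u /ou_mle -/T /A -/T mulrA.
  move: b3 p1 p2 p3 p4; rewrite uE; move: (A n w) (_ / T) (_ / T) => A' q2 q1.
  rewrite ltr_norml => /andP[A1 A2] p1 p2 p3 p4; rewrite -addrA.
  have k1 : k <= (4 * theta)^-1 by rewrite ge_min lexx.
  have k2 : k * ((1 + 2 * theta) * (2 * theta)) <= a.
    by rewrite -ler_pdivlMr// ge_min lexx orbT.
  (* Both boundary terms lie in [0, k], so their difference is at most k in absolute value, not 2
     k. *)
  apply: le_trans k2; apply: mle_perturbation => //.
    by rewrite ler_norml; apply/andP; split; lra.
  by rewrite ler_norml; apply/andP; split; lra.
apply: le_trans (_ : P (B1 `|` B2 `|` B3) <= _)%E.
  apply: le_measure => //; rewrite inE; last by do 2 apply: measurableU => //.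
  rewrite -[X in measurable X]setTI.
  exact: emeasurable_fun_o_infty.
have mB12 : measurable (B1 `|` B2) by exact: measurableU.
have M12 : (P (B1 `|` B2) <= P B1 + P B2)%E by exact: measureU2.
have M123 : (P (B1 `|` B2 `|` B3) <= P (B1 `|` B2) + P B3)%E by exact: measureU2.
apply: le_trans M123 (le_trans (leeD (le_trans M12 (leeD PB1 PB2)) PB3) _).
by rewrite -!EFinD lee_fin; lra.
Unshelve. all: by end_near. Qed.
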